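(* Let $(P,Q)$ be a quasi-projection pair on a Hilbert $C^*$-module $\mathscr{H}$. Then $(P,Q)$ is harmonious if and only if $(P,Q)$ and $(P,I-Q)$ are both semi-harmonious.
   Context: $\mathfrak{A}$ is a $C^*$-algebra and $\mathscr{H}$ is a (right) Hilbert $\mathfrak{A}$-module; $\mathcal{L}(\mathscr{H})$ is the $C^*$-algebra of adjointable operators on $\mathscr{H}$, and $I$ is the identity operator on $\mathscr{H}$. For $T\in\mathcal{L}(\mathscr{H})$, $\mathcal{R}(T)$ and $T^*$ denote its range and adjoint, and $|T|=(T^*T)^{1/2}$; the bar denotes norm closure. An idempotent is $Q\in\mathcal{L}(\mathscr{H})$ with $Q^2=Q$; a projection is a self-adjoint idempotent. A closed submodule $\mathscr{M}$ of $\mathscr{H}$ is orthogonally complemented in $\mathscr{H}$ if $\mathscr{H}=\mathscr{M}+\mathscr{M}^\perp$; then $P_{\mathscr{M}}$ denotes the projection from $\mathscr{H}$ onto $\mathscr{M}$. $T\in\mathcal{L}(\mathscr{H})$ has the polar decomposition if there is a partial isometry $U\in\mathcal{L}(\mathscr{H})$ with $T=U|T|$ and $U^*U=P_{\overline{\mathcal{R}(T^* )}}$ (in particular $\overline{\mathcal{R}(T^* )}$ is orthogonally complemented). A quasi-projection pair $(P,Q)$ on $\mathscr{H}$ consists of a projection $P\in\mathcal{L}(\mathscr{H})$ and an idempotent $Q\in\mathcal{L}(\mathscr{H})$ such that $PQ^*P=PQP$, $PQ^*(I-P)=-PQ(I-P)$ and $(I-P)Q^*(I-P)=(I-P)Q(I-P)$;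 equivalently, $Q^*=(2P-I)Q(2P-I)$. It is known that $(P,I-Q)$ is then also a quasi-projection pair. A quasi-projection pair $(P,Q)$ is semi-harmonious if both $P(I-Q)$ and $(I-P)Q$ have the polar decomposition. It is harmonious if both $\overline{\mathcal{R}(PQ(I-P))}$ and $\overline{\mathcal{R}((I-P)QP)}$ are orthogonally complemented in $\mathscr{H}$. *)

(* Defs.v *)
From HB Require Import structures.
From mathcomp Require Import all_boot all_order all_algebra.
From mathcomp Require Import all_classical all_reals all_analysis.
From mathcomp Require Export complex.
Export numFieldNormedType.Exports.

Set Implicit Arguments.
Unset Strict Implicit.
Unset Printing Implicit Defensive.

Import Order.TTheory GRing.Theory Num.Theory.

Local Open Scope classical_set_scope.
Local Open Scope ring_scope.
Local Open Scope complex_scope.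

(** C*-algebras are not assumed to have a unit, so the multiplication [cmul] is
    not that of a MathComp ring. *)
HB.mixin Record isCStarAlgebra (R : realType) A
    of CompleteNormedModule R[i] A := {
  cmul : A -> A -> A;
  cstar : A -> A;
  cmulA : associative cmul;
  cmulDl : left_distributive cmul +%R;
  cmulDr : right_distributive cmul +%R;
  cmulZl : forall (k : R[i]) (a b : A), cmul (k *: a) b = k *: cmul a b;
  cmulZr : forall (k : R[i]) (a b : A), cmul a (k *: b) = k *: cmul a b;
  cnorm_mul_le : forall a b : A, `|cmul a b| <= `|a| * `|b|;
  cstarK : involutive cstar;
  cstarD : {morph cstar : a b / a + b};
  cstarZ : forall (k : R[i]) (a : A), cstar (k *: a) = k^* *: cstar a;
  cstarM : forall a b : A, cstar (cmul a b) = cmul (cstar b) (cstar a);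
  cnorm_star_mul : forall a : A, `|cmul (cstar a) a| = `|a| ^+ 2
}.

#[short(type="cstarAlgType")]
HB.structure Definition CStarAlgebra (R : realType) :=
  {A of isCStarAlgebra R A & CompleteNormedModule R[i] A}.

Definition cpositive (R : realType) (A : cstarAlgType R) (a : A) : Prop :=
  exists b : A, a = cmul (cstar b) b.

(** Right Hilbert A-modules; the inner product [inner] is conjugate-linear in the
    first variable.  The norm of the underlying Banach space is the one induced
    by the inner product, by [hnormE]. *)
HB.mixin Record isHilbertModule (R : realType) (A : cstarAlgType R) H
    of CompleteNormedModule R[i] H := {
  ract : H -> A -> H;
  inner : H -> H -> A;
  ractDl : forall (x y : H) (a : A), ract (x + y) a = ract x a + ract y a;
  ractDr : forall (x : H) (a b : A), ract x (a + b) = ract x a + ract x b;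
  ractA : forall (x : H) (a b : A), ract x (cmul a b) = ract (ract x a) b;
  ractZl : forall (k : R[i]) (x : H) (a : A), ract (k *: x) a = k *: ract x a;
  ractZr : forall (k : R[i]) (x : H) (a : A), ract x (k *: a) = k *: ract x a;
  innerDr : forall x y z : H, inner x (y + z) = inner x y + inner x z;
  innerZr : forall (k : R[i]) (x y : H), inner x (k *: y) = k *: inner x y;
  inner_ract : forall (x y : H) (a : A),
    inner x (ract y a) = cmul (inner x y) a;
  inner_star : forall x y : H, cstar (inner x y) = inner y x;
  inner_ge0 : forall x : H, cpositive (inner x x);
  inner_eq0 : forall x : H, inner x x = 0 -> x = 0;
  hnormE : forall x : H, `|x| ^+ 2 = `|inner x x|
}.

#[short(type="hilbertModType")]
HB.structure Definition HilbertModule (R : realType) (A : cstarAlgType R) :=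
  {H of isHilbertModule R A H & CompleteNormedModule R[i] H}.

Arguments inner {R A s} x y.
Arguments ract {R A s} x a.

Section InnerTheory.
Context {R : realType} {A : cstarAlgType R} {H : hilbertModType A}.
Implicit Types x y z : H.

Lemma innerBr x y z : inner x (y - z) = inner x y - inner x z.
Proof. by rewrite -scaleN1r innerDr innerZr scaleN1r. Qed.

Lemma innerDl x y z : inner (x + y) z = inner x z + inner y z.
Proof. by rewrite -inner_star innerDr cstarD !inner_star. Qed.

Lemma innerNr x y : inner x (- y) = - inner x y.
Proof. by rewrite -scaleN1r innerZr scaleN1r. Qed.

Lemma innerNl x y : inner (- x) y = - inner x y.
Proof. by rewrite -inner_star innerNr -scaleN1r cstarZ rmorphN1 scaleN1r inner_star. Qed.

Lemma inner0r x : inner x 0 = 0.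
Proof. by rewrite -(scale0r (0 : H)) innerZr scale0r. Qed.

Lemma inner0l x : inner 0 x = 0.
Proof. by apply: (addIr (inner 0 x)); rewrite -innerDl !add0r. Qed.

Lemma inner_ext x y : (forall z, inner z x = inner z y) -> x = y.
Proof.
by move=> xy; apply/eqP; rewrite -subr_eq0; apply/eqP/inner_eq0;
   rewrite innerBr xy subrr.
Qed.

End InnerTheory.

(** Elements of L(H).  The adjoint is stored with the operator; it is determined
    by it ([adjop_ext]), and linearity and boundedness are automatic. *)
Record adjop (R : realType) (A : cstarAlgType R) (H : hilbertModType A) := Adjop {
  adjop_fun :> H -> H;
  adjop_adj : H -> H;
  adjopP : forall x y : H, inner (adjop_fun x) y = inner x (adjop_adj y)
}.

Section AdjointableOperators.
Context {R : realType} {A : cstarAlgType R} {H : hilbertModType A}.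
Implicit Types S T : adjop H.

Lemma adjop_ext S T : S =1 T -> S = T.
Proof.
case: S T => [s s' sP] [t t' tP] /= st.
have {}st : s = t by exact/funext.
move: tP; rewrite -{}st => tP.
have st' : s' = t'.
  by apply/funext => y; apply: inner_ext => z; rewrite -sP tP.
by move: tP; rewrite -st' => tP; congr Adjop; exact: Prop_irrelevance.
Qed.

HB.instance Definition _ := gen_eqMixin (adjop H).
HB.instance Definition _ := gen_choiceMixin (adjop H).

Lemma adj_subproof T x y : inner (adjop_adj T x) y = inner x (T y).
Proof. by rewrite -inner_star -adjopP inner_star. Qed.

Definition adj T : adjop H := Adjop (adj_subproof T).

Fact adjop0_subproof (x y : H) : inner (0 : H) y = inner x (0 : H).
Proof. by rewrite inner0r inner0l. Qed.

Fact adjopN_subproof T x y : inner (- T x) y = inner x (- adj T y).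
Proof. by rewrite innerNl innerNr adjopP. Qed.

Fact adjopD_subproof S T x y :
  inner (S x + T x) y = inner x (adj S y + adj T y).
Proof. by rewrite innerDl innerDr !adjopP. Qed.

Fact adjopM_subproof S T x y : inner (S (T x)) y = inner x (adj T (adj S y)).
Proof. by rewrite !adjopP. Qed.

Fact adjop1_subproof (x y : H) : inner x y = inner x y.
Proof. by []. Qed.

Definition adjop0 : adjop H := Adjop adjop0_subproof.
Definition adjopN T : adjop H := Adjop (adjopN_subproof T).
Definition adjopD S T : adjop H := Adjop (adjopD_subproof S T).
Definition adjop1 : adjop H := Adjop adjop1_subproof.
Definition adjopM S T : adjop H := Adjop (adjopM_subproof S T).

Fact adjop_addA : associative adjopD.
Proof. by move=> S T U; apply: adjop_ext => x /=; rewrite addrA. Qed.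
Fact adjop_addC : commutative adjopD.
Proof. by move=> S T; apply: adjop_ext => x /=; rewrite addrC. Qed.
Fact adjop_add0 : left_id adjop0 adjopD.
Proof. by move=> S; apply: adjop_ext => x /=; rewrite add0r. Qed.
Fact adjop_addN : left_inverse adjop0 adjopN adjopD.
Proof. by move=> S; apply: adjop_ext => x /=; rewrite addNr. Qed.
Fact adjop_mulA : associative adjopM.
Proof. by move=> S T U; apply: adjop_ext. Qed.
Fact adjop_mul1l : left_id adjop1 adjopM.
Proof. by move=> S; apply: adjop_ext. Qed.
Fact adjop_mul1r : right_id adjop1 adjopM.
Proof. by move=> S; apply: adjop_ext. Qed.
Fact adjop_mulDl : left_distributive adjopM adjopD.
Proof. by move=> S T U; apply: adjop_ext. Qed.

Lemma adjop_additive T x y : T (x + y) = T x + T y.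
Proof.
by apply: inner_ext => z; rewrite innerDr -!(adj_subproof T) innerDr.
Qed.

Fact adjop_mulDr : right_distributive adjopM adjopD.
Proof. by move=> S T U; apply: adjop_ext => x /=; rewrite adjop_additive. Qed.

(** [*%R] is composition and [1] is the identity operator.  H may be zero,
    hence only a [pzRingType]. *)
HB.instance Definition _ := GRing.isPzRing.Build (adjop H)
  adjop_addA adjop_addC adjop_add0 adjop_addN
  adjop_mulA adjop_mul1l adjop_mul1r adjop_mulDl adjop_mulDr.

End AdjointableOperators.

Section QuasiProjectionPairs.
Context {R : realType} {A : cstarAlgType R} {H : hilbertModType A}.
Implicit Types (M : set H) (P Q S T U : adjop H).

Definition idempotent_op Q : Prop := Q * Q = Q.

Definition projection P : Prop := idempotent_op P /\ adj P = P.

Definition partial_isometry U : Prop := projection (adj U * U).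

Definition orthogonal_complement M : set H :=
  [set x | forall y, M y -> inner x y = 0].

Definition orthogonally_complemented M : Prop :=
  forall x : H, exists y z : H,
    [/\ M y, orthogonal_complement M z & x = y + z].

Definition closed_range T : set H := closure (range T).

Definition is_projection_onto P M : Prop := projection P /\ range P = M.

Definition positive_op S : Prop := exists B : adjop H, S = adj B * B.

(** [S = |T|]: the positive square root is unique, so [|T|] is described by a
    relation rather than picked by a choice operator. *)
Definition is_abs T S : Prop := positive_op S /\ S * S = adj T * T.

Definition has_polar_decomposition T : Prop :=
  exists U S : adjop H,
    [/\ is_abs T S, partial_isometry U, T = U * S
      & is_projection_onto (adj U * U) (closed_range (adj T))].

Definition quasi_projection_pair P Q : Prop :=
  [/\ projection P, idempotent_op Q,
      P * adj Q * P = P * Q * P,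
      P * adj Q * (1 - P) = - (P * Q * (1 - P))
    & (1 - P) * adj Q * (1 - P) = (1 - P) * Q * (1 - P)].

Definition semi_harmonious P Q : Prop :=
  has_polar_decomposition (P * (1 - Q))
  /\ has_polar_decomposition ((1 - P) * Q).

Definition harmonious P Q : Prop :=
  orthogonally_complemented (closed_range (P * Q * (1 - P)))
  /\ orthogonally_complemented (closed_range ((1 - P) * Q * P)).

End QuasiProjectionPairs.

(* Main.v *)
Require Import Defs.
From mathcomp Require Import all_boot all_order all_algebra.
From mathcomp Require Import all_classical all_reals all_analysis.
From mathcomp Require Import ring lra.
From Stdlib Require Ncring_tac.

Set Implicit Arguments.
Unset Strict Implicit.
Unset Printing Implicit Defensive.
Import Order.TTheory GRing.Theory Num.Theory.
Local Open Scope classical_set_scope.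
Local Open Scope ring_scope.
Local Open Scope complex_scope.

(** For a closed range to be orthogonally complemented means that every x is
    y + z with y in the closure of R(T) and T^* z = 0 ([splits]).  The theorem
    then has two ingredients.

    The first is that T has a polar decomposition exactly when both closures,
    of R(T) and of R(T^* ), are complemented ([polar_splits]).  One direction
    reads the two projections U^*U and UU^* off the partial isometry U.  The
    other needs |T|, hence square roots of T^*T among the adjointable operators,
    and a partial isometry extending |T| x |-> T x
    ([partial_isometry_exists]).  Square roots come from the iteration
    v |-> (w + v^2)/2, which converges in norm to 1 - sqrt (1 - w) for every
    self-adjoint contraction w ([nearid_sqrt]); it remains to see that T^*T is
    within distance 1 of the identity when T is a contraction
    ([nearid_adjM]).  This is the theorem that elements T^*T of a C*-algebra
    are positive.  It is obtained here without spectra: if s is the square root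
    of (T^*T)^2, then W = T (s - T^*T) has W^*W negative, so that WW^* is
    positive, and comparing square roots through the relation
    WW^* W = W W^*W forces W = 0 and s = T^*T.

    The second ingredient is elementary.  Write a = PQP and b = PQ(1 - P).  Then
    Q^* = JQJ with J = 2P - 1, hence bb^* = a^2 - a.  If the closure of R(b) is
    complemented, then on its complement in the range of P the operator a is
    idempotent, so adding its range there to the closure of R(b) complements
    R(PQ) ([splits_row]).  The adjoint side follows: the range of the idempotent
    Q is complemented ([idempotent_range_split]), and inside it R(QP) is
    separated from the vectors fixed by Q and killed by P
    ([splits_column]), while Q^*P = J(QP).  All of this is symmetric under
    Q |-> 1 - Q and P |-> 1 - P ([qpp_compl], [qpp_swap]).  Conversely, if the
    ranges of PQ and P(1 - Q) are complemented, removing both complements leaves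
    a vector y that lies in the closures of R(a) and of R(P - a); then
    y = a y + (P - a) y lies in the closure of R(a(P - a)), which is contained
    in that of R(b) ([splits_offdiag]). *)

(** * Identities in noncommutative rings *)

(** Makes the reflexive decision procedure for noncommutative rings available on
    the ring of adjointable operators. *)
#[local] Instance pzRing_ops (K : pzRingType) :
  @Ncring.Ring_ops K 0 1 (fun x y => x + y) (fun x y => x * y)
    (fun x y => x - y) (fun x => - x) eq := {}.
#[local] Instance pzRing_ncring (K : pzRingType) :
  @Ncring.Ring _ _ _ _ _ _ _ _ (pzRing_ops K).
Proof.
split; rewrite /Algebra_syntax.equality /Algebra_syntax.addition
  /Algebra_syntax.multiplication /Algebra_syntax.subtraction
  /Algebra_syntax.opposite /Algebra_syntax.zero /Algebra_syntax.one /=;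
  first [ exact _ | exact: add0r | exact: addrC | exact: addrA | exact: mul1r
        | exact: mulr1 | exact: mulrA | exact: mulrDl
        | (move=> *; exact: mulrDr) | (move=> *; exact: subrr) | idtac].
all: try by move=> ? ? -> ? ? ->.
all: try by move=> ? ? ->.
all: by [].
Qed.
Ltac nring := Ncring_tac.non_commutative_ring.

(** * Real-valued norms and completeness *)

Section RealNorm.
Context {R : realType} {V : normedModType R[i]}.
Implicit Types (x y : V) (e : R).

(** The norm takes its values in [R[i]], where order is partial; its real part
    lives in a totally ordered field, in which estimates can be decided. *)
Definition nrm x : R := complex.Re `|x|.

Lemma nrmE x : `|x| = (nrm x)%:C.
Proof. by rewrite /nrm RRe_real// normr_real. Qed.

Lemma nrm_ge0 x : 0 <= nrm x.
Proof. by rewrite -lecR -nrmE normr_ge0. Qed.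

Lemma nrm_triangle x y : nrm (x + y) <= nrm x + nrm y.
Proof. by rewrite -lecR rmorphD/= -!nrmE ler_normD. Qed.

Lemma nrmN x : nrm (- x) = nrm x.
Proof. by rewrite /nrm normrN. Qed.

Lemma nrm0 : nrm 0 = 0.
Proof. by rewrite /nrm normr0. Qed.

Lemma nrm_sym x y : nrm (x - y) = nrm (y - x).
Proof. by rewrite /nrm distrC. Qed.

Lemma nrm_dist x y z : nrm (x - z) <= nrm (x - y) + nrm (y - z).
Proof. by rewrite -[x - z](subrKA y) nrm_triangle. Qed.

Lemma nrmZ (k : R) x : nrm (k%:C *: x) = `|k| * nrm x.
Proof.
apply: complexI; rewrite rmorphM/= -!nrmE normrZ; congr (_ * _).
by rewrite normc_def /= expr0n addr0 sqrtr_sqr.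
Qed.

Lemma nrmZi x : nrm ('i%C *: x) = nrm x.
Proof. by rewrite /nrm normrZ normc_def /= expr0n expr1n add0r sqrtr1 mul1r. Qed.

Lemma nrm_eq0 x : nrm x = 0 -> x = 0.
Proof. by move=> x0; apply/eqP; rewrite -normr_eq0 nrmE x0. Qed.

Lemma nrm_le_eps0 x : (forall e, 0 < e -> nrm x <= e) -> x = 0.
Proof.
move=> xe; apply: nrm_eq0; apply/eqP; rewrite eq_le nrm_ge0 andbT.
by apply/ler_addgt0Pr => e e0; rewrite add0r xe.
Qed.

Lemma closureP (M : set V) x :
  closure M x <-> forall e, 0 < e -> exists2 y, M y & nrm (x - y) < e.
Proof.
split=> [cx e e0|cx U /nbhs_normP[/= e e0 eU]].
  have /cx [y [My]] : nbhs x (ball x e%:C) by apply: nbhsx_ballx; rewrite ltcR.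
  rewrite -ball_normE /= => xy.
  by exists y => //; rewrite -ltcR -nrmE.
have eE : e = (complex.Re e)%:C by rewrite RRe_real// gtr0_real.
have [|y My xy] := cx (complex.Re e); first by rewrite -ltcR -eE.
by exists y; split => //; apply: eU; rewrite /= nrmE eE ltcR.
Qed.

End RealNorm.

(** All limits below are taken through this form of completeness, which keeps the
    rate of convergence. *)
Lemma complete_limit (R : realType) (V : completeNormedModType R[i])
    (z : nat -> V) (e : nat -> R) :
  (forall n m, (n <= m)%N -> nrm (z m - z n) <= e n) ->
  (forall d, 0 < d -> exists n, e n < d) ->
  exists l, forall n, nrm (l - z n) <= e n.
Proof.
move=> ze e0.
have : cauchy (z @ \oo).
  apply: cauchy_exP => d d0.
  have dE : d = (complex.Re d)%:C by rewrite RRe_real// gtr0_real.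
  have [|n en] := e0 (complex.Re d); first by rewrite -ltcR -dE.
  exists (z n), n => // m /= nm; rewrite -ball_normE /=.
  by rewrite distrC nrmE dE ltcR (le_lt_trans (ze _ _ nm)).
move=> /cauchy_cvg /cvg_ex[l zl]; exists l => n.
apply/ler_addgt0Pr => d d0.
have /zl [m _ lm] : nbhs l (ball l d%:C) by apply: nbhsx_ballx; rewrite ltcR.
have := lm (maxn n m) (leq_maxr _ _).
rewrite -ball_normE /= nrmE ltcR => ld.
by have := nrm_dist l (z (maxn n m)) (z n); have := ze _ _ (leq_maxl n m); lra.
Qed.
Lemma expr_small (R : realType) (q c d : R) :
  0 <= q -> q < 1 -> 0 < d -> exists n, c * q ^+ n < d.
Proof.
move=> q0 q1 d0.
have : (fun n => c * q ^+ n) @ \oo --> c * 0.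
  by apply: cvgMr; apply: cvg_expr; rewrite ger0_norm.
rewrite mulr0 => /cvgrPdist_lt/(_ _ d0)[n _ /(_ n (leqnn n))] /=.
by rewrite sub0r normrN => h; exists n; apply: le_lt_trans h; exact: ler_norm.
Qed.

Lemma double_scale (R : realType) (V : lmodType R[i]) (x : V) :
  (2 : R)%:C *: x = x + x.
Proof. by rewrite rmorph_nat scaler_nat mulr2n. Qed.

Lemma conj_real (R : realType) (k : R) : Num.conj k%:C = k%:C.
Proof. exact: conjc_real. Qed.

Lemma conj_i (R : realType) : Num.conj ('i%C : R[i]) = - 'i%C.
Proof. by apply/eqP; rewrite eq_complex /= oppr0 !eqxx. Qed.

(** * Inner products and adjointable operators *)

Section Operators.
Context {R : realType} {A : cstarAlgType R} {H : hilbertModType A}.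
Implicit Types (x y z : H) (S T U W : adjop H).

Lemma innerZl (k : R[i]) x y : inner (k *: x) y = Num.conj k *: inner x y.
Proof. by rewrite -inner_star innerZr cstarZ inner_star. Qed.

Lemma nrm_inner x : nrm (inner x x) = nrm x ^+ 2.
Proof. by apply: complexI; rewrite rmorphXn/= -!nrmE hnormE. Qed.

Lemma nrm_inner_sym x y : nrm (inner x y + inner y x) <= (nrm x + nrm y) ^+ 2.
Proof.
have E : 2%:C *: (inner x y + inner y x) =
    inner (x + y) (x + y) - inner (x - y) (x - y).
  rewrite double_scale.
  have sq (v : H) : inner (x + v) (x + v) =
      inner x x + inner v v + (inner x v + inner v x).
    by rewrite innerDr !innerDl [inner x v + inner v v]addrC addrACA
      [inner v x + _]addrC.
  rewrite !sq !innerNr !innerNl opprK -(opprD (inner x y)) opprB.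
  set s := inner x y + inner y x; set d := inner x x + inner y y.
  by rewrite [d + s]addrC [RHS]addrACA subrr addr0.
have : nrm (2%:C *: (inner x y + inner y x)) <= 2 * (nrm x + nrm y) ^+ 2.
  have d1 := nrm_triangle x y; have d2 := nrm_triangle x (- y).
  rewrite nrmN in d2; rewrite E.
  have := nrm_triangle (inner (x + y) (x + y)) (- inner (x - y) (x - y)).
  rewrite nrmN !nrm_inner => /le_trans; apply.
  by rewrite mulrDl mul1r lerD// lerXn2r// ?nnegrE ?addr_ge0// ?nrm_ge0//.
by rewrite nrmZ ger0_norm// ler_pM2l.
Qed.

(** Any constant gives continuity; this one comes from polarization and the
    triangle inequality, applied to unit multiples of x and y. *)
Lemma nrm_inner_le x y : nrm (inner x y) <= 4 * nrm x * nrm y.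
Proof.
have le2 (u v : H) : nrm (inner u v) <= (nrm u + nrm v) ^+ 2.
  have := nrm_inner_sym u v; have := nrm_inner_sym u ('i%C *: v).
  rewrite nrmZi innerZr innerZl conj_i scaleNr -scalerBr nrmZi => h1 h2.
  have : nrm (2%:C *: inner u v) <= (nrm u + nrm v) ^+ 2 + (nrm u + nrm v) ^+ 2.
    have -> : 2%:C *: inner u v =
        (inner u v - inner v u) + (inner u v + inner v u).
      by rewrite addrACA addNr addr0 double_scale.
    by apply: le_trans (nrm_triangle _ _) _; lra.
  by rewrite nrmZ ger0_norm//; lra.
have [/nrm_eq0->|x0] := eqVneq (nrm x) 0.
  by rewrite inner0l !nrm0 mulr0 mul0r.
have [/nrm_eq0->|y0] := eqVneq (nrm y) 0.
  by rewrite inner0r !nrm0 !mulr0.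
have {}x0 : 0 < nrm x by rewrite lt_def x0 nrm_ge0.
have {}y0 : 0 < nrm y by rewrite lt_def y0 nrm_ge0.
have := le2 ((nrm x)^-1%:C *: x) ((nrm y)^-1%:C *: y).
rewrite innerZr innerZl conj_real !nrmZ.
rewrite !ger0_norm ?invr_ge0 ?nrm_ge0// !mulVf ?gt_eqF//.
rewrite mulrA -invfM ler_pdivrMl ?mulr_gt0// => /le_trans; apply.
by rewrite le_eqVlt; apply/orP; left; apply/eqP; ring.
Qed.

Lemma opD S T x : (S + T) x = S x + T x. Proof. by []. Qed.
Lemma opN T x : (- T) x = - T x. Proof. by []. Qed.
Lemma opB S T x : (S - T) x = S x - T x. Proof. by []. Qed.
Lemma opM S T x : (S * T) x = S (T x). Proof. by []. Qed.
Lemma op1 x : (1 : adjop H) x = x. Proof. by []. Qed.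
Lemma op0 x : (0 : adjop H) x = 0. Proof. by []. Qed.
Definition opE := (opB, opD, opN, opM, op1, op0).

Lemma opDr T x y : T (x + y) = T x + T y.
Proof. exact: adjop_additive. Qed.

Lemma opZr T (k : R[i]) x : T (k *: x) = k *: T x.
Proof.
by apply: inner_ext => z; rewrite innerZr -!(adj_subproof T) innerZr.
Qed.

Lemma opNr T x : T (- x) = - T x.
Proof. by rewrite -scaleN1r opZr scaleN1r. Qed.

Lemma opBr T x y : T (x - y) = T x - T y.
Proof. by rewrite opDr opNr. Qed.

Lemma op0r T : T 0 = 0.
Proof. by rewrite -(scale0r (0 : H)) opZr !scale0r. Qed.

Lemma innerMl T x y : inner (T x) y = inner x (adj T y).
Proof. exact: adjopP. Qed.

Lemma innerMr T x y : inner x (T y) = inner (adj T x) y.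
Proof. by rewrite adj_subproof. Qed.

Lemma adjK T : adj (adj T) = T.
Proof. exact: adjop_ext. Qed.
Lemma adjD S T : adj (S + T) = adj S + adj T.
Proof. exact: adjop_ext. Qed.
Lemma adjN T : adj (- T) = - adj T.
Proof. exact: adjop_ext. Qed.
Lemma adjM S T : adj (S * T) = adj T * adj S.
Proof. exact: adjop_ext. Qed.
Lemma adj1 : adj (1 : adjop H) = 1.
Proof. exact: adjop_ext. Qed.
Lemma adj0 : adj (0 : adjop H) = 0.
Proof. exact: adjop_ext. Qed.
Definition adjE := (adjD, adjN, adjM, adj1, adj0, adjK).

Fact scalar_op_subproof (k : R[i]) x y : 
    inner (k *: x) y = inner x (Num.conj k *: y).
Proof. by rewrite innerZl innerZr. Qed.

Definition scalar_op (k : R[i]) : adjop H := Adjop (scalar_op_subproof k).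

Lemma scalar_opE k x : scalar_op k x = k *: x. Proof. by []. Qed.

Lemma scalar_op_comm k T : T * scalar_op k = scalar_op k * T.
Proof. by apply: adjop_ext => x; rewrite !opE !scalar_opE opZr. Qed.

Lemma adj_scalar_op k : adj (scalar_op k) = scalar_op (Num.conj k).
Proof. exact: adjop_ext. Qed.

Lemma scalar_opM k l : scalar_op k * scalar_op l = scalar_op (k * l).
Proof. by apply: adjop_ext => x; rewrite !opE !scalar_opE scalerA. Qed.

Lemma scalar_opD k l : scalar_op k + scalar_op l = scalar_op (k + l).
Proof. by apply: adjop_ext => x; rewrite !opE !scalar_opE scalerDl. Qed.

Lemma scalar_op1 : scalar_op 1 = 1.
Proof. by apply: adjop_ext => x; rewrite !opE scalar_opE scale1r. Qed.

Definition bounded_by (t : R) T := forall x, nrm (T x) <= t * nrm x.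

Lemma bounded_byM s t S T : 0 <= s ->
  bounded_by s S -> bounded_by t T -> bounded_by (s * t) (S * T).
Proof.
move=> s0 bS bT x; rewrite opM (le_trans (bS _))// -mulrA ler_wpM2l//.
Qed.

Lemma bounded_byD s t S T :
  bounded_by s S -> bounded_by t T -> bounded_by (s + t) (S + T).
Proof.
move=> bS bT x; rewrite opD mulrDl (le_trans (nrm_triangle _ _))// lerD//.
Qed.

Lemma bounded_byN t T : bounded_by t T -> bounded_by t (- T).
Proof. by move=> bT x; rewrite opN nrmN. Qed.

Lemma bounded_byZ (k : R) t T :
  bounded_by t T -> bounded_by (`|k| * t) (scalar_op k%:C * T).
Proof.
by move=> bT x; rewrite opM scalar_opE nrmZ -mulrA ler_wpM2l.
Qed.

Lemma bounded_byW s t T : s <= t -> bounded_by s T -> bounded_by t T.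
Proof.
by move=> st bT x; apply: le_trans (bT x) _; rewrite ler_wpM2r// nrm_ge0.
Qed.

Lemma bounded_by1 : bounded_by 1 1.
Proof. by move=> x; rewrite op1 mul1r. Qed.

Lemma bounded_by0 : bounded_by 0 0.
Proof. by move=> x; rewrite op0 nrm0 mul0r. Qed.

(** Uniform boundedness by a gliding hump.  If T were unbounded, choose z_n in
    the unit ball with 16^-n |T z_n| >= n and add vectors +- u_n of norm 16^-n,
    parallel to T z_n, the sign being such that the pairing of T z_n with the
    partial sum stays at least 16^-n |T z_n|.  The later terms are too small to
    undo this, so the sum l has pairings <T z_n, l> = <z_n, T^* l> that tend to
    infinity although |z_n| <= 1. *)
Lemma adjop_bounded T : exists2 t, 0 < t & bounded_by t T.
Proof.
apply: contrapT => nb.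
have big c : exists z, nrm z <= 1 /\ c < nrm (T z).
  apply: contrapT => nz; apply: nb; exists (Num.max c 1).
    by rewrite lt_max ltr01 orbT.
  move=> x; have [/nrm_eq0->|x0] := eqVneq (nrm x) 0.
    by rewrite op0r !nrm0 mulr0.
  have {}x0 : 0 < nrm x by rewrite lt_def x0 nrm_ge0.
  rewrite leNgt; apply/negP => h; apply: nz; exists ((nrm x)^-1%:C *: x).
  rewrite opZr !nrmZ ger0_norm ?invr_ge0 ?nrm_ge0// mulVf ?gt_eqF//; split=> //.
  rewrite ltr_pdivlMl// mulrC; apply: le_lt_trans h.
  by rewrite ler_pM2r// le_max lexx.
pose r n : R := 16^-1 ^+ n.
have r0 n : 0 < r n by rewrite exprn_gt0// invr_gt0.
have rS n : r n = 16 * r n.+1.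
  by rewrite /r exprS mulrA divff ?mul1r// pnatr_eq0.
have /choice[z zP] n := big (n%:R / r n).
have z0 n : 0 < nrm (T (z n)).
  by apply: le_lt_trans (zP n).2; rewrite divr_ge0// ltW.
pose u n := (r n / nrm (T (z n)))%:C *: T (z n).
have nu n : nrm (u n) = r n.
  by rewrite nrmZ ger0_norm ?divr_ge0 ?nrm_ge0 ?ltW// divfK// gt_eqF.
pose m n := r n * nrm (T (z n)).
have mu n : nrm (inner (T (z n)) (u n)) = m n.
  rewrite /u innerZr nrmZ ger0_norm ?divr_ge0 ?nrm_ge0 ?ltW// nrm_inner.
  by rewrite expr2 mulrA divfK// gt_eqF.
(* One of the two signs works, as the pairings with x + u and x - u differ by
   twice the pairing with u. *)
pose step n x := if m n <= nrm (inner (T (z n)) (x + u n))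
  then x + u n else x - u n.
have stepP n x : m n <= nrm (inner (T (z n)) (step n x)).
  rewrite /step; case: ifPn => //; rewrite -ltNge => lt.
  have : nrm (2%:C *: inner (T (z n)) (u n)) <=
      nrm (inner (T (z n)) (x + u n)) + nrm (inner (T (z n)) (x - u n)).
    rewrite -(nrmN (inner _ (x - _))); apply: le_trans (nrm_triangle _ _).
    rewrite -innerNr -innerDr opprB addrC subrKA -innerZr.
    by rewrite double_scale.
  by rewrite nrmZ mu ger0_norm//; lra.
pose x := fix x n := if n is k.+1 then step k (x k) else 0.
have xS n : nrm (x n.+1 - x n) <= r n.
  by rewrite /= /step -nu; case: ifP => _; rewrite addrAC subrr add0r ?nrmN.
(* 16/15 is the sum of the geometric series of ratio 1/16. *)
have [l lP] : exists l, forall n, nrm (l - x n) <= 16 / 15 * r n.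
  apply: complete_limit => [n k nk|d d0].
    suff : nrm (x k - x n) <= 16 / 15 * (r n - r k) by have := r0 k; lra.
    rewrite -(subnK nk); elim: (k - n)%N => [|j].
      by rewrite add0n !subrr nrm0 mulr0.
    have := nrm_dist (x (j.+1 + n)%N) (x (j + n)%N) (x n).
    by rewrite addSn; have := xS (j + n)%N; have := rS (j + n)%N; lra.
  by apply: expr_small => //; rewrite ?invr_ge0 ?invf_lt1 ?ltr1n.
have lt n : n%:R * 11 / 15 <= 4 * nrm (adj T l).
  have h1 : nrm (inner (T (z n)) l) <= 4 * nrm (adj T l).
    rewrite innerMl (le_trans (nrm_inner_le _ _))// ler_wpM2r ?nrm_ge0//.
    by rewrite ler_piMr// (zP n).1.
  have h2 := stepP n (x n); have h3 := lP n.+1.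
  have h4 : m n <= nrm (inner (T (z n)) l) + nrm (inner (T (z n)) (l - x n.+1)).
    apply: le_trans h2 _; rewrite -(nrmN (inner _ (l - _))).
    apply: le_trans (nrm_triangle _ _); rewrite -innerBr.
    by rewrite opprB addrC subrK.
  have h5 : nrm (inner (T (z n)) (l - x n.+1)) <= 4 / 15 * m n.
    apply: le_trans (nrm_inner_le _ _) _; rewrite /m rS.
    have := ler_wpM2l (ltW (z0 n)) h3; lra.
  have := (zP n).2; rewrite ltr_pdivrMr// -/(m n).
  by rewrite mulrC -/(m n); lra.
have h8 : 0 <= 8 * nrm (adj T l) by rewrite mulr_ge0// nrm_ge0.
by have := archi_boundP h8; have := lt (Num.bound (8 * nrm (adj T l))); lra.
Qed.

End Operators.
(** * Square roots *)

Section SquareRoots.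
Context {R : realType} {A : cstarAlgType R} {H : hilbertModType A}.
Implicit Types (x y z : H) (S T U W : adjop H).

Definition rscal (k : R) : adjop H := scalar_op k%:C.

Lemma rscal_comm k T : T * rscal k = rscal k * T.
Proof. exact: scalar_op_comm. Qed.
Lemma adj_rscal k : adj (rscal k) = rscal k.
Proof. by rewrite adj_scalar_op conj_real. Qed.
Lemma rscalM k l : rscal k * rscal l = rscal (k * l).
Proof. by rewrite scalar_opM -rmorphM. Qed.
Lemma rscalD k l : rscal k + rscal l = rscal (k + l).
Proof. by rewrite scalar_opD -rmorphD. Qed.
Lemma rscal1 : rscal 1 = 1.
Proof. by rewrite /rscal rmorph1 scalar_op1. Qed.
Lemma rscalN k : rscal (- k) = - rscal k.
Proof. by apply: adjop_ext => x; rewrite opE !scalar_opE rmorphN scaleNr. Qed.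
Lemma rscalB k l : rscal k - rscal l = rscal (k - l).
Proof. by rewrite -rscalN rscalD. Qed.
Lemma rscalMM k l S T : (rscal k * S) * (rscal l * T) = rscal (k * l) * (S * T).
Proof.
by rewrite -rscalM !mulrA -[X in X * T]mulrA (rscal_comm l S) !mulrA.
Qed.
Lemma rscalK k S T : k != 0 -> rscal k * S = T -> S = rscal k^-1 * T.
Proof. by move=> k0 <-; rewrite mulrA rscalM mulVf// rscal1 mul1r. Qed.
Lemma rscal_eq0 k T : k != 0 -> rscal k * T = 0 -> T = 0.
Proof. by move=> k0 /(rscalK k0) ->; rewrite mulr0. Qed.

Lemma bounded_rscal (k t : R) T : 0 <= k -> bounded_by t T ->
  bounded_by (k * t) (rscal k * T).
Proof. by move=> k0 bT; rewrite -{1}(ger0_norm k0); exact: bounded_byZ. Qed.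

Lemma halves T : rscal 2^-1 * T + rscal 2^-1 * T = T.
Proof.
by rewrite -mulrDl rscalD (_ : 2^-1 + 2^-1 = 1) ?rscal1 ?mul1r//; field.
Qed.

Lemma double_eq0 T : T = - T -> T = 0.
Proof. by move=> e; rewrite -[T]halves {2}e mulrN subrr. Qed.

Lemma adjM_eq0 T : adj T * T = 0 -> T = 0.
Proof.
move=> t0; apply: adjop_ext => x; apply: inner_eq0.
by rewrite innerMl -opM t0 inner0r.
Qed.

Lemma isometry_nrm T x : adj T * T = 1 -> nrm (T x) = nrm x.
Proof.
move=> t1; apply: (pexpIrn (n := 2)); rewrite ?nnegrE ?nrm_ge0//.
by rewrite -!nrm_inner innerMl -opM t1.
Qed.

(** A fixed point V of V = (W + V^2)/2 satisfies (1 - V)^2 = 1 - W. *)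
Fixpoint sqrt_iter W n : adjop H :=
  if n is k.+1 then rscal 2^-1 * (W + sqrt_iter W k * sqrt_iter W k) else 0.

(** The iteration for W = 1.  Every iterate is a polynomial in W with nonnegative
    coefficients, and so are the differences of successive iterates; hence they
    are bounded, for a contraction W, by these scalars and their differences. *)
Fixpoint iter_rate n : R := if n is k.+1 then (1 + iter_rate k ^+ 2) / 2 else 0.

Lemma iter_rate_ge0 n : 0 <= iter_rate n.
Proof. by case: n => //= n; rewrite divr_ge0// addr_ge0// sqr_ge0. Qed.

Lemma iter_rate_le1 n : iter_rate n <= 1.
Proof. by elim: n => //= n; have := iter_rate_ge0 n; nra. Qed.

Lemma iter_rate_gap n : 1 - iter_rate n <= 2 / n.+2%:R.
Proof.
elim: n => [|n ih] /=; first by rewrite divff ?subr0// pnatr_eq0.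
have n2 : 0 < n.+2%:R :> R by rewrite ltr0n.
have n3 : 0 < n.+3%:R :> R by rewrite ltr0n.
rewrite ler_pdivlMr// in ih.
have E : n.+3%:R = n.+2%:R + 1 :> R by rewrite -natr1.
have N : 2 <= n.+2%:R :> R by rewrite ler_nat.
rewrite E; move: (iter_rate n) (n.+2%:R : R) ih N n2 {n3 E} => q m ih N m0.
rewrite ler_pdivlMr; last lra.
have -> : (1 - (1 + q ^+ 2) / 2) * (m + 1) =
    2 - (4 + (2 * (2 - (1 - q) * m) * (m - 2) + (2 - (1 - q) * m) ^+ 2) * (m + 1))
        / (2 * m ^+ 2) by field; rewrite gt_eqF.
rewrite gerBl; apply: divr_ge0; last by rewrite mulr_ge0 ?sqr_ge0.
apply: addr_ge0 => //; apply: mulr_ge0; last lra.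
apply: addr_ge0; last exact: sqr_ge0.
by apply: mulr_ge0; [apply: mulr_ge0|]; lra.
Qed.

Lemma iter_rate_lim (c d : R) : 0 <= c -> 0 < d ->
  exists n, (1 - iter_rate n) * c < d.
Proof.
move=> c0 d0; exists (Num.bound (2 * c / d)).
have h0 : 0 <= 2 * c / d by rewrite divr_ge0 ?mulr_ge0// ltW.
have := archi_boundP h0; set n := Num.bound _ => hn.
have n2 : 0 < n.+2%:R :> R by rewrite ltr0n.
apply: (@le_lt_trans _ _ (2 / n.+2%:R * c)).
  by rewrite ler_wpM2r// iter_rate_gap.
rewrite mulrAC ltr_pdivrMr// [d * _]mulrC -ltr_pdivrMr//.
by apply: lt_le_trans hn _; rewrite ler_nat -addn2 leq_addr.
Qed.

Lemma iter_rate_eps0 (V : normedModType R[i]) (x : V) c : 0 <= c ->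
  (forall n, nrm x <= (1 - iter_rate n) * c) -> x = 0.
Proof.
move=> c0 xn; apply: nrm_le_eps0 => e /(iter_rate_lim c0)[n ne].
by apply: le_trans (xn n) _; exact: ltW.
Qed.

(** The iterates are polynomials in W, so they inherit its intertwining
    relations; in particular they commute with each other. *)
Lemma sqrt_iter_intertwine S T W n : S * W = W * T ->
  sqrt_iter S n * W = W * sqrt_iter T n.
Proof.
move=> e; elim: n => [|n ih] /=; first by rewrite mul0r mulr0.
rewrite [RHS]mulrA rscal_comm -!mulrA; congr (_ * _).
by rewrite mulrDl mulrDr e -mulrA ih !mulrA ih.
Qed.

Lemma sqrt_iter_adj W n : adj W = W -> adj (sqrt_iter W n) = sqrt_iter W n.
Proof.
move=> sW; elim: n => [|n ih] /=; first by rewrite adj0.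
by rewrite !adjE adj_rscal sW ih rscal_comm.
Qed.

Lemma sqrt_iter_bound W n : bounded_by 1 W ->
  bounded_by (iter_rate n) (sqrt_iter W n).
Proof.
move=> bW; elim: n => [|n ih] /=; first exact: bounded_by0.
rewrite mulrC; apply: bounded_rscal; first by rewrite invr_ge0.
by apply: bounded_byD => //; apply: bounded_byM => //; exact: iter_rate_ge0.
Qed.

Lemma iter_rate_mono n : iter_rate n <= iter_rate n.+1.
Proof. by have := sqr_ge0 (1 - iter_rate n); rewrite /=; nra. Qed.

(** The one estimate behind the convergence of the iteration: for commuting S and
    T, S^2 - T^2 = (S - T)(S + T). *)
Lemma bounded_diff_sqr s t S T : S * T = T * S -> 0 <= s ->
  bounded_by s (S - T) -> bounded_by t (S + T) ->
  bounded_by (2^-1 * (s * t)) (rscal 2^-1 * (S * S - T * T)).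
Proof.
move=> c s0 bs bt; apply: bounded_rscal; first by rewrite invr_ge0.
have -> : S * S - T * T = (S - T) * (S + T).
  by rewrite mulrDr !mulrBl c addrA subrK.
exact: bounded_byM.
Qed.

Lemma sqrt_iter_step W n : bounded_by 1 W ->
  bounded_by (iter_rate n.+1 - iter_rate n) (sqrt_iter W n.+1 - sqrt_iter W n).
Proof.
move=> bW; elim: n => [|n ih].
  by rewrite !subr0; exact: (sqrt_iter_bound 1).
have -> : sqrt_iter W n.+2 - sqrt_iter W n.+1 = rscal 2^-1 *
    (sqrt_iter W n.+1 * sqrt_iter W n.+1 - sqrt_iter W n * sqrt_iter W n).
  by rewrite [in LHS]/= -mulrBr; congr (_ * _); rewrite /=; nring.
apply: (@bounded_byW _ _ _
  (2^-1 * ((iter_rate n.+1 - iter_rate n) * (iter_rate n.+1 + iter_rate n)))).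
  by rewrite /=; lra.
apply: bounded_diff_sqr => //; last by apply: bounded_byD;
  exact: sqrt_iter_bound.
- by apply: sqrt_iter_intertwine; apply/esym/sqrt_iter_intertwine.
- by rewrite subr_ge0 iter_rate_mono.
Qed.

Lemma sqrt_iter_cauchy W n m : bounded_by 1 W -> (n <= m)%N ->
  bounded_by (iter_rate m - iter_rate n) (sqrt_iter W m - sqrt_iter W n).
Proof.
move=> bW nm; rewrite -(subnK nm); elim: (m - n)%N => [|j ih].
  by rewrite add0n !subrr; exact: bounded_by0.
rewrite addSn -[iter_rate _ - _](subrKA (iter_rate (j + n)%N)).
rewrite -[sqrt_iter _ _ - _](subrKA (sqrt_iter W (j + n)%N)).
by apply: bounded_byD => //; exact: sqrt_iter_step.
Qed.

(** In a C*-algebra these are the elements with 0 <= T <= 2.  The norm condition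
    stands in for positivity: it is stable under convex combinations by the
    triangle inequality, and it is what the iteration needs to converge. *)
Definition nearid T := adj T = T /\ bounded_by 1 (1 - T).

(** The root is 1 - V, with V the limit of the iteration started from the
    contraction 1 - T.  Since |V| <= 1, the root satisfies the same condition as
    T, so that roots can be taken repeatedly. *)
Lemma nearid_sqrt T : nearid T -> exists2 S, nearid S & S * S = T.
Proof.
move=> [sT bT]; pose W := 1 - T.
have sW : adj W = W by rewrite !adjE sT.
have /choice[v vP] x : exists l, forall n,
    nrm (l - sqrt_iter W n x) <= (1 - iter_rate n) * nrm x.
  apply: complete_limit => [n m nm|d d0]; last first.
    exact: iter_rate_lim (nrm_ge0 x) d0.
  rewrite -opB; apply: le_trans (sqrt_iter_cauchy bT nm x) _.
  by rewrite ler_wpM2r ?nrm_ge0// lerB// iter_rate_le1.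
have vadj x y : inner (v x) y = inner x (v y).
  apply/eqP; rewrite -subr_eq0; apply/eqP.
  apply: (@iter_rate_eps0 _ _ (8 * nrm x * nrm y)) => [|n].
    by rewrite !mulr_ge0 ?nrm_ge0.
  have -> : inner (v x) y - inner x (v y) =
      inner (v x - sqrt_iter W n x) y - inner x (v y - sqrt_iter W n y).
    rewrite innerBr innerDl innerNl innerMl sqrt_iter_adj//.
    by rewrite opprB subrKA.
  apply: le_trans (nrm_triangle _ _) _; rewrite nrmN.
  have h1 := nrm_inner_le (v x - sqrt_iter W n x) y.
  have h2 := nrm_inner_le x (v y - sqrt_iter W n y).
  have h3 := ler_wpM2r (nrm_ge0 y) (vP x n).
  have h4 := ler_wpM2l (nrm_ge0 x) (vP y n).
  lra.
pose V := Adjop vadj.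
have VP n : bounded_by (1 - iter_rate n) (V - sqrt_iter W n).
  by move=> x; exact: vP.
have bV : bounded_by 1 V by have := VP 0%N; rewrite /= !subr0.
have VV : V + V = W + V * V.
  suff e : V = rscal 2^-1 * (W + V * V) by rewrite {1 2}e halves.
  apply/eqP; rewrite -subr_eq0; apply/eqP; apply: adjop_ext => x.
  apply: (@iter_rate_eps0 _ _ (2 * nrm x)) => [|n].
    by rewrite mulr_ge0 ?nrm_ge0.
  have -> : V - rscal 2^-1 * (W + V * V) = (V - sqrt_iter W n.+1) +
     rscal 2^-1 *
       (sqrt_iter W n * (sqrt_iter W n - V) + (sqrt_iter W n - V) * V).
    by rewrite /=; nring.
  have q0 : 0 <= 1 - iter_rate n by rewrite subr_ge0 iter_rate_le1.
  have VPn : bounded_by (1 - iter_rate n) (sqrt_iter W n - V).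
    by rewrite -(opprB V); exact: bounded_byN.
  have h1 : bounded_by 1 (sqrt_iter W n).
    by apply: bounded_byW (sqrt_iter_bound n bT); exact: iter_rate_le1.
  have h2 := bounded_byM ler01 h1 VPn.
  have h3 := bounded_byM q0 VPn bV.
  have half0 : 0 <= 2^-1 :> R by rewrite invr_ge0.
  have h4 := bounded_rscal half0 (bounded_byD h2 h3).
  apply: le_trans (bounded_byD (VP n.+1) h4 x) _.
  by rewrite mulrA ler_wpM2r ?nrm_ge0//; have := iter_rate_mono n; lra.
exists (1 - V).
  split; last by rewrite opprB addrC subrK.
  by rewrite !adjE; congr (_ - _); exact: adjop_ext.
have -> : (1 - V) * (1 - V) = 1 - (V + V) + V * V by nring.
by rewrite VV /W; nring.
Qed.

(** Whatever S is, the iteration for 1 - S^2 converges to 1 - S, because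
    V = 1 - S solves V = (W + V^2)/2 and the error is multiplied at each step by
    (V + V_n)/2, of norm at most (1 + q_n)/2 = (1 - q_(n+1))/(1 - q_n).  The
    product of these factors telescopes to 1 - q_n, which tends to 0.  This
    gives uniqueness of square roots with a rate. *)
Lemma nearid_sqrt_limit S n : nearid S -> bounded_by 1 (1 - S * S) ->
  bounded_by (1 - iter_rate n) (1 - S - sqrt_iter (1 - S * S) n).
Proof.
move=> [sS bS] bW; set W := 1 - S * S; set V := 1 - S.
have cWV : W * V = V * W by rewrite /W /V; nring.
elim: n => [|n ih]; first by rewrite /= !subr0.
have VE : V = rscal 2^-1 * (W + V * V).
  by rewrite -[LHS]halves -mulrDr; congr (_ * _); rewrite /W /V; nring.
have -> : V - sqrt_iter W n.+1 =
    rscal 2^-1 * (V * V - sqrt_iter W n * sqrt_iter W n).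
  by rewrite {1}VE /=; nring.
apply: (@bounded_byW _ _ _ (2^-1 * ((1 - iter_rate n) * (1 + iter_rate n)))).
  by rewrite /=; lra.
apply: bounded_diff_sqr => //.
- by apply/esym/sqrt_iter_intertwine.
- by rewrite subr_ge0 iter_rate_le1.
- by apply: bounded_byD => //; exact: sqrt_iter_bound.
Qed.

(** Both roots are limits of the same polynomials in their squares. *)
Lemma sqrt_intertwine S T W : nearid S -> nearid T ->
  bounded_by 1 (1 - S * S) -> bounded_by 1 (1 - T * T) ->
  S * S * W = W * (T * T) -> S * W = W * T.
Proof.
move=> pS pT bS bT e; have [t t0 bW] := adjop_bounded W.
apply/eqP; rewrite -subr_eq0; apply/eqP; apply: adjop_ext => x.
apply: (@iter_rate_eps0 _ _ (2 * t * nrm x)) => [|n].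
  by rewrite !mulr_ge0 ?nrm_ge0// ltW.
have c : sqrt_iter (1 - S * S) n * W = W * sqrt_iter (1 - T * T) n.
  by apply: sqrt_iter_intertwine; rewrite mulrBl mulrBr e mul1r mulr1.
have -> : S * W - W * T = W * (1 - T - sqrt_iter (1 - T * T) n) -
   (1 - S - sqrt_iter (1 - S * S) n) * W +
   (W * sqrt_iter (1 - T * T) n - sqrt_iter (1 - S * S) n * W).
  nring.
rewrite c subrr addr0.
have h1 := nearid_sqrt_limit n pS bS.
have h2 := nearid_sqrt_limit n pT bT.
have e0 : 0 <= 1 - iter_rate n by rewrite subr_ge0 iter_rate_le1.
have := bounded_byD (bounded_byM (ltW t0) bW h2)
  (bounded_byN (bounded_byM e0 h1 bW)).
by move=> /(_ x); lra.
Qed.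

Lemma nearid_convex a b S T : nearid S -> nearid T ->
  0 <= a -> 0 <= b -> a + b <= 1 -> nearid (rscal a * S + rscal b * T).
Proof.
move=> [sS bS] [sT bT] a0 b0 ab; split.
  by rewrite !adjE !adj_rscal sS sT !rscal_comm.
have -> : 1 - (rscal a * S + rscal b * T) =
    rscal (1 - a - b) * 1 + (rscal a * (1 - S) + rscal b * (1 - T)).
  by rewrite -!rscalB rscal1; nring.
have c0 : 0 <= 1 - a - b by lra.
apply: (@bounded_byW _ _ _ ((1 - a - b) * 1 + (a * 1 + b * 1))); first by lra.
apply: bounded_byD; [|apply: bounded_byD]; apply: bounded_rscal => //.
exact: bounded_by1.
Qed.

Definition iop : adjop H := scalar_op 'i%C.

Lemma iop_comm T : T * iop = iop * T. Proof. exact: scalar_op_comm. Qed.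
Lemma adj_iop : adj iop = - iop.
Proof.
rewrite adj_scalar_op conj_i; apply: adjop_ext => x.
by rewrite opE !scalar_opE scaleNr.
Qed.
Lemma iop_sqr : iop * iop = -1.
Proof.
apply: adjop_ext => x.
by rewrite !opE !scalar_opE scalerA -expr2 sqr_i scaleN1r.
Qed.

(** If S is the root of 1 - T^2, then T + iS and T - iS are unitary, so their
    difference 2iS has norm at most 2; hence 1 - T^2 = S^2 is a contraction. *)
Lemma nearid_sqr T : adj T = T -> bounded_by 1 T -> nearid (T * T).
Proof.
move=> sT bT; split; first by rewrite adjE sT.
have bTT : bounded_by 1 (T * T) by rewrite -[1]mulr1; exact: bounded_byM.
have [S pS SS] : exists2 S, nearid S & S * S = 1 - T * T.
  by apply: nearid_sqrt; split; rewrite ?adjE ?sT// subKr.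
have ST : S * T = T * S.
  by apply: sqrt_intertwine => //; rewrite SS ?subKr//; nring.
have sS := pS.1.
have u1 : adj (T + iop * S) * (T + iop * S) = 1.
  rewrite !adjE adj_iop sS sT mulrN iop_comm.
  have -> : (T - iop * S) * (T + iop * S) =
     T * T + T * iop * S - iop * S * T - iop * (S * iop) * S by nring.
  rewrite (iop_comm T) (iop_comm S).
  have -> : T * T + iop * T * S - iop * S * T - iop * (iop * S) * S =
     T * T + iop * (T * S - S * T) - iop * iop * (S * S) by nring.
  by rewrite iop_sqr ST subrr mulr0 SS; nring.
have u2 : adj (T - iop * S) * (T - iop * S) = 1.
  rewrite !adjE adj_iop sS sT mulrN iop_comm.
  have -> : (T - - (iop * S)) * (T - iop * S) =
     T * T - T * iop * S + iop * S * T - iop * (S * iop) * S by nring.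
  rewrite (iop_comm T) (iop_comm S).
  have -> : T * T - iop * T * S + iop * S * T - iop * (iop * S) * S =
     T * T - iop * (T * S - S * T) - iop * iop * (S * S) by nring.
  by rewrite iop_sqr ST subrr mulr0 SS; nring.
rewrite -SS -[1]mulr1.
suff bS : bounded_by 1 S by exact: bounded_byM.
move=> x; have := nrm_triangle ((T + iop * S) x) (- ((T - iop * S) x)).
rewrite nrmN (isometry_nrm _ u1) (isometry_nrm _ u2).
have -> : (T + iop * S) x - (T - iop * S) x = 2%:C *: (iop * S) x.
  by rewrite double_scale -opB -opD; congr (adjop_fun _ x); nring.
by rewrite nrmZ opM scalar_opE nrmZi ger0_norm//; lra.
Qed.

Lemma nearid_scale a S : nearid S -> 0 <= a -> a <= 1 -> nearid (rscal a * S).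
Proof.
move=> pS a0 a1; rewrite -[_ * _]addr0 -(mul0r S).
have -> : 0 = rscal 0.
  by apply: adjop_ext => x; rewrite scalar_opE rmorph0 scale0r.
by apply: nearid_convex => //; rewrite addr0.
Qed.

(** With W = p + iq, the real and imaginary parts satisfy
    WW^* + W^*W = 2(p^2 + q^2). *)
Lemma star_sum_squares W : let p := rscal 2^-1 * (W + adj W) in
    let q := rscal 2^-1 * (iop * (W - adj W)) in
  [/\ adj p = p, adj q = q &
      p * p + q * q = rscal 2^-1 * (W * adj W + adj W * W)].
Proof.
move=> p q; split.
- by rewrite /p !adjE adj_rscal rscal_comm addrC.
- rewrite /q !adjE adj_rscal adj_iop rscal_comm; congr (_ * _).
  by rewrite mulrN iop_comm -mulrN opprB.
rewrite /p /q !rscalMM.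
have -> : iop * (W - adj W) * (iop * (W - adj W)) =
    - ((W - adj W) * (W - adj W)).
  by rewrite -!mulrA (mulrA _ iop) iop_comm -!mulrA mulrA iop_sqr mulN1r.
have -> : rscal 2^-1 = rscal (2^-1 * 2^-1) * (1 + 1) :> adjop H.
  by rewrite -rscal1 rscalD rscalM; congr rscal; field.
rewrite -mulrDr -mulrA; congr (_ * _); nring.
Qed.

(** Positivity of T^*T.  With a = T^*T, let s be the root of a^2 and r the root of
    s; they commute with a, and n = s - a satisfies an = -sn.  Hence, up to a
    scalar, W = Tn has W^*W = nan = -(rn)^2, and by [star_sum_squares] WW^* is a
    sum of squares of self-adjoint operators.  So e = WW^* and f = -W^*W are both
    within the reach of [sqrt_intertwine], and from eW = -Wf follows
    e^2 W = W f^2, then eW = Wf.  Both relations together give eW = 0, whence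
    W = 0, an = 0, n^2 = 0 and finally s = a. *)
Lemma nearid_adjM T : bounded_by 1 T -> bounded_by 1 (adj T) ->
  nearid (adj T * T).
Proof.
move=> bT bT'; set a := adj T * T.
have sa : adj a = a by rewrite /a !adjE.
have ba : bounded_by 1 a by rewrite -[1]mulr1; exact: bounded_byM.
have paa := nearid_sqr sa ba.
have [s ps ss] := nearid_sqrt paa.
have [r pr rr] := nearid_sqrt ps.
have sa_comm : s * a = a * s.
  by apply: sqrt_intertwine => //; rewrite ss ?mulrA//; exact: paa.2.
have ra_comm : r * a = a * r.
  by apply: sqrt_intertwine => //; rewrite rr ?ps.2//; exact: ps.2.
suff -> : a = s by [].
pose n := s - a.
have rn : r * n = n * r by rewrite /n mulrBr mulrBl ra_comm -rr mulrA.
have sn : adj n = n by rewrite /n adjD adjN sa ps.1.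
have an : a * n = - (s * n) by rewrite /n !mulrBr sa_comm ss; nring.
have b2 S : nearid S -> bounded_by 2 S.
  move=> [_ bS]; rewrite -[S](subKr 1) (_ : 2 = 1 + 1)//.
  by apply: bounded_byD; [exact: bounded_by1|exact: bounded_byN].
have bn : bounded_by 3 n.
  rewrite (_ : 3 = 2 + 1); last by ring.
  by apply: bounded_byD; [exact: b2|exact: bounded_byN].
(* The bounds |r| <= 2, |n| <= 3 and |T| <= 1 are absorbed by the factor 1/8. *)
pose W := rscal 8^-1 * (T * n); pose k := rscal 8^-1 * (r * n).
have sk : adj k = k by rewrite /k adjM (adjM r) adj_rscal pr.1 sn rscal_comm rn.
have bk : bounded_by 1 k.
  apply: (@bounded_byW _ _ _ (8^-1 * (2 * 3))); first by lra.
  apply: bounded_rscal; rewrite ?invr_ge0//.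
  by apply: bounded_byM => //; exact: b2.
have aWE : adj W = rscal 8^-1 * (n * adj T).
  by rewrite /W adjM (adjM T) adj_rscal sn rscal_comm.
have bW : bounded_by 1 W.
  apply: (@bounded_byW _ _ _ (8^-1 * (1 * 3))); first by lra.
  by apply: bounded_rscal; rewrite ?invr_ge0//; exact: bounded_byM.
have bW' : bounded_by 1 (adj W).
  rewrite aWE; apply: (@bounded_byW _ _ _ (8^-1 * (3 * 1))); first by lra.
  by apply: bounded_rscal; rewrite ?invr_ge0//; exact: bounded_byM.
have WWk : adj W * W = - (k * k).
  rewrite aWE /W /k !rscalMM -mulrN; congr (_ * _).
  rewrite [RHS](_ : _ = n * - (s * n)).
    by rewrite -an /a; nring.
  by rewrite -rr {1}rn; nring.
have WE : W = rscal 8^-1 * (T * n) by [].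
clearbody W k.
have pk : nearid (k * k) by exact: nearid_sqr.
pose e := rscal 8^-1 * (W * adj W); pose f := rscal 8^-1 * (k * k).
have pf : nearid f by apply: nearid_scale => //; lra.
have pe : nearid e.
  have [sp sq pq] := star_sum_squares W.
  set p := rscal _ * (W + _) in sp pq; set q := rscal _ * (iop * _) in sq pq.
  have -> : e = rscal 2^-1 * (rscal 2^-1 * (p * p) + rscal 2^-1 * (q * q)) +
      rscal 8^-1 * (k * k).
    rewrite -mulrDr pq WWk !mulrA !rscalM.
    rewrite (_ : 2^-1 / 2 / 2 = 8^-1 :> R); last by field.
    by rewrite /e; nring.
  have bp : bounded_by 1 p.
    apply: (@bounded_byW _ _ _ (2^-1 * (1 + 1))); first by lra.
    by apply: bounded_rscal; rewrite ?invr_ge0//; exact: bounded_byD.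
  have bq : bounded_by 1 q.
    apply: (@bounded_byW _ _ _ (2^-1 * (1 + 1))); first by lra.
    apply: bounded_rscal; rewrite ?invr_ge0// => x.
    rewrite opM scalar_opE nrmZi.
    by apply: (bounded_byD bW (bounded_byN bW')).
  apply: nearid_convex; [|by []|lra|lra|lra].
  apply: nearid_convex; [exact: nearid_sqr|exact: nearid_sqr|lra|lra|lra].
have eW : e * W = - (W * f).
  rewrite /e -!mulrA WWk [W * f]mulrA rscal_comm; nring.
have b8 S T' : bounded_by 1 S -> bounded_by 1 T' ->
    bounded_by 1 (rscal 8^-1 * (S * T')).
  move=> bS bS'; apply: (@bounded_byW _ _ _ (8^-1 * (1 * 1))); first by lra.
  by apply: bounded_rscal; rewrite ?invr_ge0//; exact: bounded_byM.
have eWf : e * W = W * f.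
  apply: sqrt_intertwine => //.
  - by apply: (nearid_sqr pe.1 _).2; exact: b8.
  - by apply: (nearid_sqr pf.1 _).2; exact: b8.
  - have -> : e * e * W = e * (e * W) by nring.
    rewrite eW; have -> : e * - (W * f) = - (e * W * f) by nring.
    by rewrite eW; nring.
have W0 : W = 0.
  have : e * W = 0 by apply: double_eq0; rewrite {1}eWf eW opprK.
  rewrite /e -mulrA => /rscal_eq0 h.
  (* WW^*W = 0 gives (W^*W)^2 = 0. *)
  apply: adjM_eq0; apply: adjM_eq0.
  by rewrite !adjE -!mulrA (mulrA W) h ?mulr0// invr_eq0 pnatr_eq0.
have Tn0 : T * n = 0.
  by apply: (@rscal_eq0 8^-1); rewrite -?WE// invr_eq0 pnatr_eq0.
have an0 : a * n = 0 by rewrite /a -mulrA Tn0 mulr0.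
have sn0 : s * n = 0 by rewrite -[LHS]opprK -an an0 oppr0.
have : n = 0.
  apply: adjM_eq0; rewrite sn {1}/n mulrBl sn0 an0 subrr//.
by move/eqP; rewrite subr_eq0 => /eqP.
Qed.

End SquareRoots.
(** * Polar decompositions *)

Section PolarDecomposition.
Context {R : realType} {A : cstarAlgType R} {H : hilbertModType A}.
Implicit Types (x y z w : H) (S T U W K : adjop H).

Lemma adjop_bounded2 T :
  exists2 t, 0 < t & bounded_by t T /\ bounded_by t (adj T).
Proof.
have [s s0 bs] := adjop_bounded T; have [t t0 bt] := adjop_bounded (adj T).
exists (Num.max s t); first by rewrite lt_max s0.
by split; [apply: bounded_byW bs|apply: bounded_byW bt];
  rewrite le_max lexx ?orbT.
Qed.

(** [nearid_adjM] for an arbitrary T, after division by a common bound of T and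
    T^*. *)
Lemma nearid_scaled_adjM T :
  exists2 t, 0 < t & nearid (rscal (t ^- 2) * (adj T * T)).
Proof.
have [t t0 [bT bT']] := adjop_bounded2 T; exists t => //.
have t'0 : 0 <= t^-1 by rewrite invr_ge0 ltW.
have b1 S : bounded_by t S -> bounded_by 1 (rscal t^-1 * S).
  by move=> /(bounded_rscal t'0); rewrite mulVf ?gt_eqF.
rewrite expr2 invfM -rscalMM.
have <- : adj (rscal t^-1 * T) = rscal t^-1 * adj T.
  by rewrite adjM adj_rscal rscal_comm.
by apply: nearid_adjM; [exact: b1|rewrite adjM adj_rscal rscal_comm; exact: b1].
Qed.

(** A second root B of the root S shows that S is itself of the form B^*B. *)
Lemma abs_exists T : exists S, is_abs T S.
Proof.
have [t t0 pT] := nearid_scaled_adjM T.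
have [S pS SS] := nearid_sqrt pT; have [B pB BB] := nearid_sqrt pS.
exists (rscal t * S); split.
  exists (rscal (Num.sqrt t) * B).
  rewrite adjM adj_rscal pB.1 rscal_comm rscalMM BB.
  by rewrite -expr2 sqr_sqrtr// ltW.
rewrite rscalMM SS mulrA rscalM -expr2 divff ?rscal1 ?mul1r//.
by rewrite expf_eq0/= gt_eqF.
Qed.

Lemma neumann q K y : 0 <= q -> q < 1 -> bounded_by q K ->
  exists x, x - K x = y.
Proof.
move=> q0 q1 bK; pose z := fix z n := if n is k.+1 then y + K (z k) else 0.
pose C := nrm y / (1 - q).
have p0 : 0 < 1 - q by lra.
have C0 : 0 <= C by rewrite divr_ge0 ?nrm_ge0// ltW.
have zS n : nrm (z n.+1 - z n) <= (1 - q) * C * q ^+ n.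
  elim: n => [|n ih].
    by rewrite /= op0r addr0 subr0 mulr1 /C mulrC divfK// gt_eqF.
  have -> : z n.+2 - z n.+1 = K (z n.+1 - z n).
    by rewrite opBr /= opprD addrACA subrr add0r.
  by rewrite (le_trans (bK _))// exprS mulrCA ler_wpM2l.
have [|d d0|l lP] := @complete_limit _ _ z (fun n => C * q ^+ n).
- move=> n m nm; suff : nrm (z m - z n) <= C * (q ^+ n - q ^+ m).
    by have := mulr_ge0 C0 (exprn_ge0 m q0); lra.
  rewrite -(subnK nm); elim: (m - n)%N => [|j ih].
    by rewrite add0n !subrr nrm0 mulr0.
  have := nrm_dist (z (j.+1 + n)%N) (z (j + n)%N) (z n).
  by rewrite addSn exprS; have := zS (j + n)%N; lra.
- exact: expr_small.
exists l; apply/eqP; rewrite -subr_eq0; apply/eqP.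
apply: nrm_le_eps0 => e /(expr_small (2 * C) q0 q1)[n ne].
have -> : l - K l - y = l - z n.+1 - K (l - z n).
  by rewrite opBr /= opprB opprD -[RHS]addrA subrKA addrA addrAC.
apply: le_trans (nrm_triangle _ _) _; rewrite nrmN.
have h1 := lP n.+1; rewrite exprS in h1; have h2 := ler_wpM2l q0 (lP n).
have h3 := bK (l - z n).
have := mulr_ge0 C0 (exprn_ge0 n q0) => h4.
have : 0 <= (1 - q) * (C * q ^+ n) by rewrite mulr_ge0// ltW.
lra.
Qed.

(** With c = t^2 and K = (c - T^*T)/(1 + c), the equation (1 + T^*T) x = y reads
    x - K x = y/(1 + c), and K is a strict contraction because T^*T/c is within
    distance 1 of the identity. *)
Lemma one_plus_adjM_surj T y : exists x, (1 + adj T * T) x = y.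
Proof.
have [t t0 [_ bT]] := nearid_scaled_adjM T.
set c := t ^+ 2; have c0 : 0 < c by rewrite exprn_gt0.
set G := adj T * T; have c1 : 0 < 1 + c by rewrite addr_gt0.
have bK : bounded_by ((1 + c)^-1 * (c * 1))
    (rscal (1 + c)^-1 * (rscal c * (1 - rscal c^-1 * G))).
  by do 2!(apply: bounded_rscal; first by rewrite ?invr_ge0 ltW).
have [|//|x xP] := neumann (rscal (1 + c)^-1 y) _ _ bK.
- by apply: mulr_ge0; rewrite ?mulr1 ?invr_ge0 ltW.
- by rewrite mulr1 ltr_pdivrMl// mulr1; lra.
exists x; have /(congr1 (rscal (1 + c))) := xP.
rewrite -opM rscalM divff ?gt_eqF// rscal1 op1 => <-.
rewrite -[in RHS](op1 x) -opM -opB -opM; congr (adjop_fun _ x).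
have V (k : R) W : 0 < k -> rscal k * (rscal k^-1 * W) = W.
  by move=> k0; rewrite mulrA rscalM divff ?gt_eqF// rscal1 mul1r.
have -> : rscal (1 + c) *
    (1 - rscal (1 + c)^-1 * (rscal c * (1 - rscal c^-1 * G)) * 1) =
  rscal (1 + c) - rscal (1 + c) * (rscal (1 + c)^-1 *
    (rscal c - rscal c * (rscal c^-1 * G))) by nring.
rewrite !V//.
by rewrite -rscalD rscal1; nring.
Qed.

Lemma closed_rangeP T y :
  closed_range T y <-> forall e, 0 < e -> exists w, nrm (y - T w) < e.
Proof.
split=> [/closureP h e /h[_ [w _ <-] we]|h]; first by exists w.
by apply/closureP => e /h[w we]; exists (T w) => //; exists w.
Qed.

Lemma closed_range_self T w : closed_range T (T w).
Proof. by apply/closed_rangeP => e e0; exists w; rewrite subrr nrm0. Qed.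

Lemma closed_rangeD T y z :
  closed_range T y -> closed_range T z -> closed_range T (y + z).
Proof.
move=> /closed_rangeP hy /closed_rangeP hz; apply/closed_rangeP => e e0.
have e2 : 0 < e / 2 by rewrite divr_gt0.
have [v vy] := hy _ e2; have [w wz] := hz _ e2; exists (v + w).
rewrite opDr opprD addrACA; apply: le_lt_trans (nrm_triangle _ _) _; lra.
Qed.

Lemma closed_rangeM S T y : closed_range T y -> closed_range (S * T) (S y).
Proof.
move=> /closed_rangeP h; apply/closed_rangeP => e e0.
have [t t0 bS] := adjop_bounded S.
have [w wy] := h (e / t) (divr_gt0 e0 t0); exists w.
rewrite opM -opBr (le_lt_trans (bS _))// mulrC -ltr_pdivlMr//.
Qed.

Lemma closed_range_sub S T y :
  (forall w, closed_range T (S w)) -> closed_range S y -> closed_range T y.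
Proof.
move=> ST /closed_rangeP h; apply/closed_rangeP => e e0.
have e2 : 0 < e / 2 by rewrite divr_gt0.
have [v vy] := h _ e2; have /closed_rangeP/(_ _ e2)[w wy] := ST v; exists w.
by apply: le_lt_trans (nrm_dist _ (S v) _) _; lra.
Qed.

Lemma closed_range_mulr S T y : closed_range (S * T) y -> closed_range S y.
Proof. by apply: closed_range_sub => w; exact: closed_range_self. Qed.

Lemma closed_range_fix S T y : S * T = T -> closed_range T y -> S y = y.
Proof.
move=> ST /closed_rangeP h; have [t t0 bS] := adjop_bounded S.
apply/eqP; rewrite -subr_eq0; apply/eqP; apply: nrm_le_eps0 => e e0.
have t1 : 0 < t + 1 by rewrite addr_gt0.
have [w wy] := h (e / (t + 1)) (divr_gt0 e0 t1).
have -> : S y - y = S (y - T w) - (y - T w).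
  by rewrite opBr -opM ST opprB addrA subrK.
apply: le_trans (nrm_triangle _ _) _; rewrite nrmN.
rewrite ltr_pdivlMr// in wy; have := bS (y - T w); lra.
Qed.

Lemma inner_closed_range T y z :
  closed_range T y -> adj T z = 0 -> inner z y = 0.
Proof.
move=> /closed_rangeP h z0; apply: nrm_le_eps0 => e e0.
have c0 : 0 < 4 * nrm z + 1 by have := nrm_ge0 z; lra.
have [w wy] := h (e / (4 * nrm z + 1)) (divr_gt0 e0 c0).
have -> : inner z y = inner z (y - T w).
  by rewrite innerBr innerMr z0 inner0l subr0.
apply: le_trans (nrm_inner_le _ _) _.
rewrite ltr_pdivlMr// in wy; have := nrm_ge0 (y - T w); lra.
Qed.

(** The orthogonal complement of the closure of R(T) is the kernel of T^*, so
    this says that the closure is orthogonally complemented. *)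
Definition splits T := forall x, exists y z,
  [/\ closed_range T y, adj T z = 0 & x = y + z].

Lemma complemented_splits T :
  orthogonally_complemented (closed_range T) <-> splits T.
Proof.
split=> h x; have [y [z [hy hz ->]]] := h x; exists y, z; split=> //.
  apply: inner_eq0; rewrite innerMl adjK; apply: hz; exact: closed_range_self.
by move=> w hw; exact: inner_closed_range hw hz.
Qed.

(** A self-adjoint unitary carries the range of T and its orthogonal complement
    to those of JT. *)
Lemma splits_reflect J T : adj J = J -> J * J = 1 -> splits T -> splits (J * T).
Proof.
move=> sJ JJ h x; have [y [z [hy hz e]]] := h (J x).
exists (J y), (J z); split; first exact: closed_rangeM.
  by rewrite adjM sJ -opM -mulrA JJ mulr1.
by rewrite -opDr -e -opM JJ.
Qed.

(** Since |Sw| = |Tw|, a sequence Sw_n converging to y makes Tw_n a Cauchy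
    sequence; its limit u is the value at y of the isometry Sw |-> Tw. *)
Lemma isometry_graph S T y : adj S * S = adj T * T -> closed_range S y ->
  exists u, forall e, 0 < e ->
    exists w, nrm (y - S w) < e /\ nrm (u - T w) < e.
Proof.
move=> ST /closed_rangeP h.
have nST w : nrm (S w) = nrm (T w).
  apply: (pexpIrn (n := 2)); rewrite ?nnegrE ?nrm_ge0//.
  by rewrite -!nrm_inner !innerMl -!opM ST.
have r0 n : 0 < 2^-1 ^+ n :> R by rewrite exprn_gt0// invr_gt0.
have /choice[w wP] n := h _ (r0 n).
have [|d d0|u uP] :=
  @complete_limit _ _ (fun n => T (w n)) (fun n => 2 * 2^-1 ^+ n).
- move=> n m nm; rewrite -opBr -nST opBr.
  have := nrm_dist (S (w m)) y (S (w n)); rewrite (nrm_sym _ y).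
  have : 2^-1 ^+ m <= 2^-1 ^+ n :> R.
    by rewrite ler_wiXn2l// ?invr_ge0// invf_le1// ler1n.
  by have := wP m; have := wP n; lra.
- by apply: expr_small => //; rewrite ?invr_ge0// invf_lt1// ltr1n.
exists u => e e0.
have [n ne] : exists n, 2 * 2^-1 ^+ n < e.
  by apply: expr_small => //; rewrite ?invr_ge0// invf_lt1// ltr1n.
exists (w n); split; last exact: le_lt_trans (uP n) ne.
by have := wP n; have := r0 n; lra.
Qed.

Lemma inner_limit x x' y y' :
  (forall e, 0 < e -> exists a b,
     [/\ nrm (y - a) < e, nrm (y' - b) < e & inner x a = inner x' b]) ->
  inner x y = inner x' y'.
Proof.
move=> h; apply/eqP; rewrite -subr_eq0; apply/eqP.
apply: nrm_le_eps0 => e e0.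
have c0 : 0 < 4 * (nrm x + nrm x') + 1.
  by have := nrm_ge0 x; have := nrm_ge0 x'; lra.
have [a [b [ya yb ab]]] := h _ (divr_gt0 e0 c0).
have -> : inner x y - inner x' y' = inner x (y - a) - inner x' (y' - b).
  by rewrite !innerBr ab opprB addrA subrK.
apply: le_trans (nrm_triangle _ _) _; rewrite nrmN.
have h1 := nrm_inner_le x (y - a); have h2 := nrm_inner_le x' (y' - b).
set d := e / _ in ya yb; have d0 : 0 < d by exact: divr_gt0.
have dE : e = d * (4 * (nrm x + nrm x') + 1) by rewrite divfK// gt_eqF.
have h3 := ler_wpM2l (nrm_ge0 x) (ltW ya).
have h4 := ler_wpM2l (nrm_ge0 x') (ltW yb).
rewrite dE; lra.
Qed.

(** The isometry Sw |-> Tw extends to the closure of R(S) and by 0 to its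
    complement; the same recipe applied to Tw |-> Sw yields a map v.  That v is
    an adjoint of u is checked on ranges, where it reads
    <Tw, Tw'> = <Sw, Sw'>, and passes to the limit in one variable at a time. *)
Lemma partial_isometry_exists S T : adj S * S = adj T * T ->
  splits S -> splits T -> exists U : adjop H,
    [/\ U * S = T, adj U * T = S & forall z, adj S z = 0 -> U z = 0].
Proof.
move=> ST sS sT.
pose graph (S T : adjop H) x u := exists y z, [/\ adj S z = 0, x = y + z &
  forall e, 0 < e -> exists w, nrm (y - S w) < e /\ nrm (u - T w) < e].
have graph_ex (S' T' : adjop H) : adj S' * S' = adj T' * T' -> splits S' ->
    forall x, exists u, graph S' T' x u.
  move=> e s x; have [y [z [hy hz xE]]] := s x.
  by have [u uP] := isometry_graph e hy; exists u, y, z.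
have /choice[u uP] := graph_ex _ _ ST sS.
have /choice[v vP] := graph_ex _ _ (esym ST) sT.
have SvE w x : inner (S w) (v x) = inner (T w) x.
  have [y [z [hz -> yP]]] := vP x.
  rewrite innerDr (innerMl T w z) hz inner0r addr0.
  apply: inner_limit => e /yP[w' [h1 h2]]; exists (S w'), (T w'); split=> //.
  by rewrite !innerMl -!opM ST.
have TuE w x : inner (T w) (u x) = inner (S w) x.
  have [y [z [hz -> yP]]] := uP x.
  rewrite innerDr (innerMl S w z) hz inner0r addr0.
  apply: inner_limit => e /yP[w' [h1 h2]]; exists (T w'), (S w'); split=> //.
  by rewrite !innerMl -!opM ST.
have zv z x : adj S z = 0 -> inner z (v x) = 0.
  move=> z0; have [y [z' [_ _ yP]]] := vP x.
  apply: (@inner_closed_range S) => //.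
  by apply/closed_rangeP => e /yP[w [_ h]]; exists w.
have zu z x : adj T z = 0 -> inner z (u x) = 0.
  move=> z0; have [y [z' [_ _ yP]]] := uP x.
  apply: (@inner_closed_range T) => //.
  by apply/closed_rangeP => e /yP[w [_ h]]; exists w.
have uv x x' : inner (u x) x' = inner x (v x').
  have [y [z [hz xE yP]]] := uP x.
  rewrite {2}xE innerDl (zv z)// addr0.
  rewrite -[LHS]inner_star -[RHS]inner_star; congr cstar.
  apply: inner_limit => e /yP[w [h1 h2]]; exists (T w), (S w); split=> //.
  by rewrite -[LHS]inner_star -[RHS]inner_star SvE.
exists (Adjop uv); split.
- apply: adjop_ext => w; apply: inner_ext => z.
  rewrite -[LHS]inner_star -[RHS]inner_star; congr cstar.
  by rewrite -SvE; exact: uv.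
- apply: adjop_ext => w; apply: inner_ext => z.
  rewrite -[LHS]inner_star -[RHS]inner_star; congr cstar.
  by rewrite -TuE; exact: (adj_subproof (Adjop uv)).
- by move=> z z0; apply: inner_eq0; rewrite uv zv.
Qed.

(** S and T have the same kernel as S^2 = T^*T.  Splitting S w along the closure
    of R(T^* ) leaves a part in that kernel and orthogonal to R(S), hence 0;
    splitting w along the closure of R(T) puts T^* w in the closure of
    R(T^*T) = R(S^2).  So the closures of R(S) and R(T^* ) agree. *)
Lemma splits_abs S T : is_abs T S -> splits T -> splits (adj T) ->
  [/\ splits S, forall y, closed_range S y <-> closed_range (adj T) y
    & adj S = S].
Proof.
move=> [[B SB] SS] sT sT'.
have sS : adj S = S by rewrite SB !adjE.
have Tker z : T z = 0 -> S z = 0.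
  move=> Tz; apply: inner_eq0.
  by rewrite innerMl sS -opM SS opM Tz op0r inner0r.
have ST w : closed_range (adj T) (S w).
  have [y [z [hy]]] := sT' (S w); rewrite adjK => Tz SwE.
  suff -> : S w = y by [].
  suff z0 : z = 0 by rewrite SwE z0 addr0.
  apply: inner_eq0.
  have zE : z = S w - y by rewrite SwE addrC addKr.
  rewrite {2}zE innerBr innerMr sS Tker// inner0l.
  by rewrite (inner_closed_range hy) ?adjK// subr0.
have TS w : closed_range S (adj T w).
  have [y [z [hy hz ->]]] := sT w.
  rewrite opDr hz addr0; have := closed_rangeM (S := adj T) hy.
  by rewrite -SS; exact: closed_range_mulr.
have cE y : closed_range S y <-> closed_range (adj T) y.
  by split; exact: closed_range_sub.
split=> // x; have [y [z [hy hz xE]]] := sT' x; exists y, z; split=> //.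
- exact/cE.
- by rewrite sS Tker// -[T]adjK.
Qed.

Lemma polar_splits T :
  has_polar_decomposition T <-> splits T /\ splits (adj T).
Proof.
split.
  move=> [U [S [[[B SB] SS] [pU1 pU2] TE [_ rE]]]].
  have sS : adj S = S by rewrite SB !adjE.
  set E := adj U * U in pU1 pU2 rE.
  have EE y : closed_range (adj T) y -> E y = y.
    by rewrite -rE => -[w _ <-]; rewrite -opM pU1.
  (* The defining property of a partial isometry, from U^*U being a projection:
     (U - UE)^*(U - UE) = 0. *)
  have EU : U * E = U.
    apply/eqP; rewrite -subr_eq0; apply/eqP; apply: adjM_eq0.
    rewrite adjD adjN (adjM U) pU2.
    have -> : (E * adj U - adj U) * (U * E - U) =
        (E * (adj U * U) - adj U * U) * (E - 1) by nring.
    by rewrite -/E pU1 subrr mul0r.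
  have UcS w : closed_range T (U (E w)).
    rewrite TE; apply: closed_rangeM.
    have : closed_range (adj T) (E w) by rewrite -rE; exists w.
    by rewrite TE adjM sS; exact: closed_range_mulr.
  split=> x.
    exists (U (adj U x)), (x - U (adj U x)); split.
    - by rewrite -{1}EU opM.
    - rewrite TE adjM opM opBr -[adj U (U _)]opM -/E.
      have -> : E (adj U x) = adj U x.
        by rewrite -opM -[in RHS]EU adjM pU2.
      by rewrite subrr op0r.
    - by rewrite addrC subrK.
  exists (E x), (x - E x); split.
  - by rewrite -rE; exists x.
  - rewrite adjK; apply: inner_eq0; rewrite innerMl.
    have /EE <- := @closed_range_self (adj T) (T (x - E x)).
    rewrite (innerMr E) pU2.
    by rewrite opBr -[E (E x)]opM pU1 subrr inner0l.
  - by rewrite addrC subrK.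
move=> [sT sT']; have [S aS] := abs_exists T.
have [sS cE saS] := splits_abs aS sT sT'.
have SST : adj S * S = adj T * T by rewrite saS aS.2.
have [U [US UT Uz]] := partial_isometry_exists SST sS sT.
set E := adj U * U.
have ES y : closed_range S y -> E y = y.
  by apply: closed_range_fix; rewrite -mulrA US.
have Ex x : closed_range S (E x).
  have [y [z [hy hz ->]]] := sS x.
  by rewrite opDr ES// opM Uz// op0r addr0.
have pE : projection E.
  by split; [apply: adjop_ext => x; rewrite opM ES|rewrite /E adjM adjK].
exists U, S; split=> //; split=> //.
apply/seteqP; split=> [_ [x _ <-]|y hy]; first exact/cE.
by exists y => //; apply: ES; exact/cE.
Qed.

End PolarDecomposition.
(** * Quasi-projection pairs *)

Section Pairs.
Context {R : realType} {A : cstarAlgType R} {H : hilbertModType A}.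
Implicit Types (x y z w : H) (P Q T : adjop H).

(** F = Q + Q^* - 1 has square 1 + D^*D with D = Q - Q^*, so F is onto; and
    F z = Q z - (1 - Q^* ) z, where the second term is in the kernel of Q^*. *)
Lemma idempotent_range_split Q x : Q * Q = Q ->
  exists u v, adj Q v = 0 /\ x = Q u + v.
Proof.
move=> QQ; have QQ' : adj Q * adj Q = adj Q by rewrite -adjM QQ.
have [z zP] := one_plus_adjM_surj (Q - adj Q) x.
pose F := Q + adj Q - 1.
have FF : 1 + adj (Q - adj Q) * (Q - adj Q) = F * F.
  rewrite !adjE /F.
  have -> : 1 + (adj Q - Q) * (Q - adj Q) =
    1 + adj Q * Q + Q * adj Q - adj Q * adj Q - Q * Q by nring.
  have -> : (Q + adj Q - 1) * (Q + adj Q - 1) =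
    Q * Q + Q * adj Q + adj Q * Q + adj Q * adj Q - Q - Q - adj Q - adj Q + 1.
    by nring.
  by rewrite QQ QQ'; nring.
exists (F z), ((adj Q - 1) (F z)); split.
  by rewrite -opM mulrBr QQ' mulr1 subrr.
rewrite -zP FF opM -opD; congr (adjop_fun _ _).
by rewrite /F; nring.
Qed.

Definition sym_of P : adjop H := P + P - 1.

Lemma qpp_offdiag P Q : quasi_projection_pair P Q ->
  (1 - P) * adj Q * P = - ((1 - P) * Q * P).
Proof.
move=> [[_ sP] _ _ h _].
by have := congr1 adj h; rewrite !adjE sP !mulrA => ->; rewrite opprK.
Qed.

(** The three block conditions together; the remaining block is the adjoint of the
    second condition. *)
Lemma qpp_adj P Q : quasi_projection_pair P Q ->
  adj Q = sym_of P * Q * sym_of P.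
Proof.
move=> hPQ; have h2' := qpp_offdiag hPQ; case: hPQ => [[PP sP] _ h1 h2 h3].
have -> : adj Q = P * adj Q * P + P * adj Q * (1 - P) +
    (1 - P) * adj Q * P + (1 - P) * adj Q * (1 - P) by nring.
by rewrite h1 h2 h2' h3 /sym_of; nring.
Qed.

Lemma adj_sym P : projection P -> adj (sym_of P) = sym_of P.
Proof. by move=> [_ sP]; rewrite !adjE sP. Qed.

Lemma sym_sqr P : projection P -> sym_of P * sym_of P = 1.
Proof.
move=> [PP _].
have -> : sym_of P * sym_of P = (P * P - P) * (1 + 1 + 1 + 1) + 1.
  by rewrite /sym_of; nring.
by rewrite PP subrr mul0r add0r.
Qed.

Lemma qpp_compl P Q : quasi_projection_pair P Q ->
  quasi_projection_pair P (1 - Q).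
Proof.
move=> [[PP sP] QQ h1 h2 h3].
have P0 : P * (1 - P) = 0 by rewrite mulrBr PP mulr1 subrr.
split=> //.
- by rewrite /Defs.idempotent_op mulrBl mul1r mulrBr mulr1 QQ subrr subr0.
- have E K : P * (1 - K) * P = P * P - P * K * P by nring.
  by rewrite !adjE !E h1.
- have E K : P * (1 - K) * (1 - P) = P * (1 - P) - P * K * (1 - P) by nring.
  by rewrite !adjE !E P0 h2 !sub0r.
- have E K : (1 - P) * (1 - K) * (1 - P) =
      (1 - P) * (1 - P) - (1 - P) * K * (1 - P) by nring.
  by rewrite !adjE !E h3.
Qed.

Lemma projection_compl P : projection P -> projection (1 - P).
Proof.
move=> [PP sP]; split; last by rewrite !adjE sP.
by rewrite /Defs.idempotent_op mulrBl mul1r mulrBr mulr1 PP subrr subr0.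
Qed.

Lemma qpp_swap P Q : quasi_projection_pair P Q ->
  quasi_projection_pair (1 - P) Q.
Proof.
move=> hPQ; have h := qpp_offdiag hPQ; case: hPQ => pP QQ h1 h2 h3.
by split; rewrite ?subKr//; exact: projection_compl.
Qed.

Lemma splitsN T : splits T -> splits (- T).
Proof.
rewrite -mulN1r; apply: splits_reflect; first by rewrite !adjE.
by nring.
Qed.

Lemma qpp_adj_range P Q w : quasi_projection_pair P Q ->
  P w = w -> P (Q w) = Q w -> adj Q w = Q w.
Proof.
move=> hPQ Pw PQw; have J v : P v = v -> sym_of P v = v.
  by move=> Pv; rewrite /sym_of !opE Pv addrK.
by rewrite (qpp_adj hPQ) !opM J// J.
Qed.

Lemma qpp_range_fixed P Q w : quasi_projection_pair P Q ->
  P w = w -> adj Q w = w -> Q w = w.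
Proof.
move=> hPQ Pw; have J : sym_of P w = w by rewrite /sym_of !opE Pw addrK.
rewrite (qpp_adj hPQ) !opM J => /(congr1 (sym_of P)).
by rewrite -opM sym_sqr ?J//; case: hPQ.
Qed.

(** Let b = PQ(1 - P), and split Px = y + z along the closure of R(b).  Then
    b^* z = 0 says that Qz stays in the range of P.  So Qz = PQz belongs to
    R(PQ).  The rest z - Qz is orthogonal to R(PQ): it is in the range of P and
    killed by Q, and Q^* agrees with Q on vectors that Q keeps in the range of P,
    so Q^* kills it too. *)
Lemma splits_row P Q : quasi_projection_pair P Q ->
  splits (P * Q * (1 - P)) -> splits (P * Q).
Proof.
move=> hPQ sb x; have [[PP sP] QQ _ _ _] := hPQ.
have PPv v : P (P v) = P v by rewrite -opM PP.
have QQv v : Q (Q v) = Q v by rewrite -opM QQ.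
have [y [z [hy hz xE]]] := sb (P x).
have Py : P y = y by apply: closed_range_fix hy; rewrite !mulrA PP.
have Pz : P z = z by apply: (addrI y); rewrite -xE -{1}Py -opDr -xE PPv.
have PQz : P (Q z) = Q z.
  move: hz; rewrite !adjM adjD adjN adj1 sP mulrA qpp_offdiag// !opE Pz.
  by move/eqP; rewrite oppr_eq0 subr_eq0 => /eqP.
exists (y + Q z), (z - Q z + (x - P x)); split.
- apply: closed_rangeD; first exact: closed_range_mulr hy.
  by rewrite -PQz -opM; exact: closed_range_self.
- rewrite adjM sP opM opDr !opBr PPv subrr addr0 Pz PQz.
  by rewrite (qpp_adj_range hPQ) ?opBr ?QQv ?Pz ?PQz ?subrr ?op0r.
- by rewrite addrA [y + Q z + _]addrACA subrr addr0 -xE addrC subrK.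
Qed.

(** By [idempotent_range_split] only vectors Qu have to be split, and of these
    only Q(1 - P)u.  Split (1 - P)u = y + z along the closure of
    R((1 - P)(1 - Q)).  On that range Q acts as Q(1 - P)(1 - Q) = - QP(1 - Q), so
    Qy is in the closure of R(QP).  Orthogonality of z means Q^*z = z, whence
    Qz = z and PQ^*z = Pz = 0. *)
Lemma splits_column P Q : quasi_projection_pair P Q ->
  splits ((1 - P) * (1 - Q)) -> splits (Q * P).
Proof.
move=> hPQ s x; have [[PP sP] QQ _ _ _] := hPQ.
have [u [v [hv ->]]] := idempotent_range_split x QQ.
have [y [z [hy hz mE]]] := s ((1 - P) u).
have P0 : (1 - P) * (1 - P) = 1 - P.
  by case: (projection_compl (conj PP sP)).
have Py : (1 - P) y = y by apply: closed_range_fix hy; rewrite mulrA P0.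
have Pz : (1 - P) z = z.
  by apply: (addrI y); rewrite -mE -{1}Py -opDr -mE -opM P0.
have Qz : adj Q z = z.
  move: hz; rewrite adjM !adjD !adjN adj1 sP opM Pz !opE => /eqP.
  by rewrite subr_eq0 => /eqP.
have Qz' := qpp_range_fixed (qpp_swap hPQ) Pz Qz.
exists (Q (P u) + Q y), (z + v); split.
- apply: closed_rangeD; first by rewrite -opM; exact: closed_range_self.
  have := closed_rangeM (S := Q) hy; rewrite mulrA.
  apply: closed_range_sub => w.
  have -> : (Q * (1 - P) * (1 - Q)) w = (Q * P) (- ((1 - Q) w)).
    have E : Q * (1 - P) * (1 - Q) = (Q - Q * Q) - Q * P * (1 - Q) by nring.
    by rewrite E QQ subrr sub0r opNr.
  exact: closed_range_self.
- rewrite adjM sP opM opDr Qz hv addr0 -Pz -opM mulrBr mulr1 PP subrr.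
  by [].
- have uE : u = P u + (y + z) by rewrite -mE !opE addrC subrK.
  by rewrite {1}uE !opDr Qz' !addrA.
Qed.

Lemma splits_adj_row P Q : quasi_projection_pair P Q ->
  splits (Q * P) -> splits (adj (P * Q)).
Proof.
move=> hPQ s; have [pP _ _ _ _] := hPQ; have [PP sP] := pP.
have -> : adj (P * Q) = sym_of P * (Q * P).
  rewrite adjM sP (qpp_adj hPQ).
  have -> : sym_of P * Q * sym_of P * P = sym_of P * Q * (P * P + P * P - P).
    by rewrite /sym_of; nring.
  by rewrite PP addrK mulrA.
by apply: splits_reflect => //; [exact: adj_sym|exact: sym_sqr].
Qed.

(** The closure of R(PQ) is that of R(PQQ^*P), and PQQ^*P = a(2a - 1) with
    a = PQP. *)
Lemma closed_range_corner P Q y : quasi_projection_pair P Q ->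
  splits (adj (P * Q)) -> closed_range (P * Q) y -> closed_range (P * Q * P) y.
Proof.
move=> hPQ s; apply: closed_range_sub => w.
have [[PP sP] QQ _ _ _] := hPQ.
have [y' [z [hy]]] := s w; rewrite adjK => hz ->.
rewrite opDr hz addr0.
have := closed_rangeM (S := P * Q) hy.
have -> : P * Q * adj (P * Q) = P * Q * P * (Q * P + Q * P - 1).
  rewrite adjM sP (qpp_adj hPQ) /sym_of.
  have -> : P * Q * ((P + P - 1) * Q * (P + P - 1) * P) =
    P * Q * P * Q * (P * P + P * P - P) + P * Q * P * Q * (P * P + P * P - P) -
    P * (Q * Q) * (P * P + P * P - P) by nring.
  by rewrite PP QQ addrK; nring.
exact: closed_range_mulr.
Qed.

(** Removing from Px the components orthogonal to R(PQ) and to R(P(1 - Q)) leaves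
    y' in both closures; the second component is fixed by Q, so its removal does
    not leave the closure of R(PQ).  With a = PQP, [closed_range_corner] puts y'
    in the closures of R(a) and of R(P - a), and both terms of
    y' = a y' + (P - a) y' lie in the closure of R(a(P - a)), where
    a(P - a) = - b(1 - Q)P and b = PQ(1 - P). *)
Lemma splits_offdiag P Q : quasi_projection_pair P Q ->
  splits (P * Q) -> splits (adj (P * Q)) ->
  splits (P * (1 - Q)) -> splits (adj (P * (1 - Q))) ->
  splits (P * Q * (1 - P)).
Proof.
move=> hPQ s1 s2 s3 s4 x; have [[PP sP] QQ _ _ _] := hPQ.
have PPv v : P (P v) = P v by rewrite -opM PP.
have [y [z [hy hz xE]]] := s1 (P x).
have Py : P y = y by apply: closed_range_fix hy; rewrite mulrA PP.
have Pz : P z = z by apply: (addrI y); rewrite -xE -{1}Py -opDr -xE PPv.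
have [y' [z' [hy' hz' yE]]] := s3 y.
have Py' : P y' = y' by apply: closed_range_fix hy'; rewrite mulrA PP.
have Pz' : P z' = z' by apply: (addrI y'); rewrite -yE -{1}Py' -opDr -yE Py.
have Qz' : adj Q z' = z'.
  move: hz'; rewrite adjM adjD adjN adj1 sP opM Pz' !opE => /eqP.
  by rewrite subr_eq0 => /eqP.
have Qz := qpp_range_fixed hPQ Pz' Qz'.
have hy1 : closed_range (P * Q) y'.
  have -> : y' = y + (P * Q) (- z') by rewrite opNr opM Qz Pz' yE addrK.
  by apply: closed_rangeD => //; exact: closed_range_self.
have c1 := closed_range_corner hPQ s2 hy1.
have c2 := closed_range_corner (qpp_compl hPQ) s4 hy'.
exists y', (z' + z + (x - P x)); split.
- have -> : y' = (P * Q * P) y' + (P * (1 - Q) * P) y'.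
    rewrite -opD; have -> : P * Q * P + P * (1 - Q) * P = P * P by nring.
    by rewrite PP Py'.
  have E1 : P * Q * P * (P * (1 - Q) * P) = P * Q * (1 - P) * - ((1 - Q) * P).
    have -> : P * Q * P * (P * (1 - Q) * P) = P * Q * (P * P) * (1 - Q) * P
      by nring.
    have -> : P * Q * (1 - P) * - ((1 - Q) * P) =
      P * Q * P * (1 - Q) * P - P * (Q - Q * Q) * P by nring.
    by rewrite PP QQ subrr mulr0 mul0r subr0.
  have E2 : P * (1 - Q) * P * (P * Q * P) = P * Q * (1 - P) * - ((1 - Q) * P).
    rewrite -E1.
    have -> : P * Q * P * (P * (1 - Q) * P) =
      P * Q * (P * P * P) - P * Q * (P * P) * Q * P by nring.
    have -> : P * (1 - Q) * P * (P * Q * P) =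
      P * P * P * Q * P - P * Q * (P * P) * Q * P by nring.
    by rewrite !PP.
  apply: closed_rangeD.
    have := closed_rangeM (S := P * Q * P) c2; rewrite E1.
    exact: closed_range_mulr.
  have := closed_rangeM (S := P * (1 - Q) * P) c1; rewrite E2.
  exact: closed_range_mulr.
- move: hz; rewrite !adjM adjD adjN adj1 sP !opM => hz.
  rewrite !opDr !opNr PPv subrr addr0 hz op0r addr0 Pz' Qz'.
  by rewrite opB op1 Pz' subrr.
- by rewrite addrA (addrA y') -yE -xE addrC subrK.
Qed.

Lemma harmonious_compl P Q : quasi_projection_pair P Q -> harmonious P Q ->
  harmonious P (1 - Q).
Proof.
move=> [[PP _] _ _ _ _] [/complemented_splits s1 /complemented_splits s2].
have E S T : S * (1 - Q) * T = S * T - S * Q * T by nring.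
split; apply/complemented_splits; rewrite E.
- by rewrite mulrBr PP mulr1 subrr sub0r; exact: splitsN.
- by rewrite mulrBl PP mul1r subrr sub0r; exact: splitsN.
Qed.

Lemma harmonious_semi P Q : quasi_projection_pair P Q -> harmonious P Q ->
  semi_harmonious P Q.
Proof.
move=> hPQ h; have [/complemented_splits s1 /complemented_splits s2] := h.
have hPQ' := qpp_compl hPQ; have hP'Q := qpp_swap hPQ.
have hP'Q' := qpp_compl hP'Q.
have [/complemented_splits s1' /complemented_splits s2'] :=
  harmonious_compl hPQ h.
have r1 : splits (P * Q) by exact: splits_row.
have r2 : splits (P * (1 - Q)) by exact: splits_row.
have r3 : splits ((1 - P) * Q) by apply: splits_row => //; rewrite subKr.
have r4 : splits ((1 - P) * (1 - Q)).
  by apply: splits_row => //; rewrite subKr.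
split; apply/polar_splits; split=> //; apply: splits_adj_row => //.
- by apply: splits_column => //; rewrite subKr.
- by apply: splits_column => //; rewrite subKr.
Qed.

End Pairs.

Theorem theorem4p2 (R : realType) (A : cstarAlgType R) (H : hilbertModType A)
    (P Q : adjop H) (hPQ : quasi_projection_pair P Q) :
  harmonious P Q <-> semi_harmonious P Q /\ semi_harmonious P (1 - Q).
Proof.
split=> [h|[[h1 h2] [h3 h4]]].
  split; first exact: harmonious_semi.
  apply: harmonious_semi; first exact: qpp_compl.
  exact: harmonious_compl.
rewrite subKr in h3 h4.
move: h1 h2 h3 h4 => /polar_splits[a1 b1] /polar_splits[a2 b2]
  /polar_splits[a3 b3] /polar_splits[a4 b4].
split; apply/complemented_splits; first exact: splits_offdiag.
rewrite -[in X in _ * X](subKr 1 P).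
by apply: splits_offdiag => //; exact: qpp_swap.
Qed.
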